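(* Let $\mu$ be a finite nonnegative Radon measure on $\mathbb R^d$ and let $w\in(L^\infty_\mu)^d$ be a unit vector field such that $w(x)\notin T_\mu(x)$ for $\mu$-a.e. $x$. Then, for every $\varepsilon>0$, there exist a compact set $K\subset\mathbb R^d$ with $\mu(\mathbb R^d\setminus K)\le\varepsilon$ and a Lipschitz function $f:\mathbb R^d\to\mathbb R$ such that the directional derivative $\partial_{w(x)}f(x)$ fails to exist at $\mu$-a.e. $x\in K$.
   Context: The directional derivative is $\partial_{w(x)}f(x)=\lim_{h\to0^+}\frac{f(x+hw(x))-f(x)}{h}$. $\mathcal D(\mathbb R^d)$ is the space of smooth compactly supported functions; $\operatorname{Lip}_1(\mathbb R^d)$ the real $1$-Lipschitz functions. Let $\mathcal M_{0,1}(\mathbb R^d)$ be the finite signed Borel measures $f$ with $\int df=0$ and $\int|x|\,d|f|<\infty$, with norm $\|f\|_{\mathrm{KR}}=\sup\{\int u\,df: u\in\operatorname{Lip}_1(\mathbb R^d)\}$. The Arens-Eells space $\mathrm{AE}(\mathbb R^d)$ is the completion of $\mathcal M_{0,1}(\mathbb R^d)$ for this norm, identified with a subspace of distributions: $f\in\mathcal D'(\mathbb R^d)$ belongs to $\mathrm{AE}(\mathbb R^d)$ iff $\langle f,\varphi_n\rangle\to0$ for every sequence $(\varphi_n)\subset\mathcal D(\mathbb R^d)$ with $\sup_n\|\nabla\varphi_n\|_\infty<\infty$ and $\varphi_n\to c$ pointwise for some constant $c\in\mathbb R$. For a nonnegative Radon measure $\mu$, set $\mathcal T_\mu:=\{\sigma\in(L^1_\mu(\mathbb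 R^d))^d: -\operatorname{div}(\sigma\mu)\in\mathrm{AE}(\mathbb R^d)\}$. There is a $\mu$-measurable map $x\mapsto T_\mu(x)$ valued in the linear subspaces of $\mathbb R^d$, unique up to $\mu$-null sets, such that for $\sigma\in(L^1_\mu)^d$: $\sigma\in\mathcal T_\mu\iff\sigma(x)\in T_\mu(x)$ $\mu$-a.e. (the MK tangent bundle). *)

(* Defs.v *)
From HB Require Import structures.
From mathcomp Require Import all_boot all_order all_algebra.
From mathcomp Require Import all_classical all_reals all_analysis.
From mathcomp Require Import measurable_realfun.

Set Implicit Arguments.
Unset Strict Implicit.
Unset Printing Implicit Defensive.

Import Order.TTheory GRing.Theory Num.Theory.
Import numFieldNormedType.Exports.

Local Open Scope classical_set_scope.
Local Open Scope ring_scope.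

(* R^d with its Borel sigma-algebra. Every finite Borel measure on R^d is Radon,
   so the finite nonnegative Radon measures are exactly the inhabitants of
   [{finite_measure set (borelRV R d) -> \bar R}]. *)
Notation borelRV R d := (g_sigma_algebraType (@open 'rV[R]_d)).

Section euclidean.
Variables (R : realType) (d : nat).
Implicit Types (u v x y : 'rV[R]_d) (f phi : 'rV[R]_d -> R).

Definition dotp u v : R := \sum_(i < d) u 0 i * v 0 i.

(* The library norm `|u| on 'rV[R]_d is the sup norm. *)
Definition enorm u : R := Num.sqrt (dotp u u).

Definition lipschitz_fun f : Prop :=
  exists L : R, forall x y, `|f x - f y| <= L * enorm (x - y).

Definition right_dderivable f x v : Prop :=
  cvg ((f (x + h *: v) - f x) / h @[h --> 0^'+]).

Definition partial (i : 'I_d) phi : 'rV[R]_d -> R :=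
  fun x => 'D_(delta_mx 0 i) phi x.

Definition iter_partial (s : seq 'I_d) phi : 'rV[R]_d -> R :=
  foldr partial phi s.

Definition grad phi x : 'rV[R]_d := \row_(i < d) partial i phi x.

(* [derive] is total, hence the explicit derivability requirement. *)
Definition smooth phi : Prop :=
  forall s : seq 'I_d, continuous (iter_partial s phi) /\
    forall x i, derivable (iter_partial s phi) x (delta_mx 0 i).

Definition test_function phi : Prop :=
  smooth phi /\ compact (closure [set x | phi x != 0]).

Definition test_cvg0 (phi_ : nat -> 'rV[R]_d -> R) : Prop :=
  (exists2 K : set 'rV[R]_d, compact K &
     forall n x, phi_ n x != 0 -> K x) /\
  (forall (s : seq 'I_d) (e : R), 0 < e ->
     \forall n \near \oo, forall x, `|iter_partial s (phi_ n) x| <= e).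

(* Functionals are total on functions R^d -> R; only their values on test
   functions matter. *)
Definition distribution (F : ('rV[R]_d -> R) -> R) : Prop :=
  (forall (a : R) phi psi, test_function phi -> test_function psi ->
     F (fun x => a * phi x + psi x) = a * F phi + F psi) /\
  (forall phi_ : nat -> 'rV[R]_d -> R, (forall n, test_function (phi_ n)) ->
     test_cvg0 phi_ -> F (phi_ n) @[n --> \oo] --> (0 : R)).

Definition arens_eells (F : ('rV[R]_d -> R) -> R) : Prop :=
  distribution F /\
  forall phi_ : nat -> 'rV[R]_d -> R, (forall n, test_function (phi_ n)) ->
    (exists M : R, forall n x, enorm (grad (phi_ n) x) <= M) ->
    (exists c : R, forall x, phi_ n x @[n --> \oo] --> c) ->
    F (phi_ n) @[n --> \oo] --> (0 : R).

End euclidean.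

Section tangent_bundle.
Variables (R : realType) (d : nat).
Variable mu : {measure set (borelRV R d) -> \bar R}.
Implicit Types (sigma : 'rV[R]_d -> 'rV[R]_d).

(* (L^p_mu)^d, through Borel representatives. *)
Definition Lvec (p : \bar R) sigma : Prop :=
  forall i : 'I_d, ((fun x => sigma x 0 i) : borelRV R d -> R) \in Lfun mu p.

(* The distribution - div (sigma mu). *)
Definition neg_div sigma (phi : 'rV[R]_d -> R) : R :=
  \int[mu]_x dotp (sigma x) (grad phi x).

Definition MK_fields sigma : Prop :=
  Lvec 1%E sigma /\ arens_eells (neg_div sigma).

(* Measurability for the mu-completion of the Borel sigma-algebra, as a
   closed-valued multifunction. *)
Definition mu_measurable_bundle (T : 'rV[R]_d -> {vspace 'rV[R]_d}) : Prop :=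
  forall U : set 'rV[R]_d, open U ->
    completed_algebra_gen mu
      ([set x | exists2 v, v \in T x & U v] : set (borelRV R d)).

(* This determines T up to mu-null sets. *)
Definition MK_tangent_bundle (T : 'rV[R]_d -> {vspace 'rV[R]_d}) : Prop :=
  mu_measurable_bundle T /\
  forall sigma, Lvec 1%E sigma ->
    (MK_fields sigma <-> \forall x \ae mu, sigma x \in T x).

End tangent_bundle.

(* Main.v *)
Require Import Defs.
From HB Require Import structures.
From mathcomp Require Import all_boot all_order all_algebra.
From mathcomp Require Import all_classical all_reals all_analysis.
From mathcomp Require Import measurable_realfun ring lra.

Set Implicit Arguments.
Unset Strict Implicit.
Unset Printing Implicit Defensive.

Import Order.TTheory GRing.Theory Num.Theory.
Import numFieldNormedType.Exports.

Local Open Scope classical_set_scope.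
Local Open Scope ring_scope.

(** Why the theorem holds.

    Let [A] be a Borel set of positive measure.  The field [1_A w] is not a
    section of [T], so the distribution [- div (1_A w mu)] is not in the
    Arens-Eells space: there are test functions [phi_n], with bounded gradients
    and converging pointwise to a constant [c], such that the integrals of
    [w . grad phi_n] over [A] stay away from [0].  Being equi-Lipschitz, the
    [u_n = phi_n - c] tend to [0] uniformly on balls: they are small functions
    with a slope along [w] that is not small.

    The gradients can be made convergent.  The pairs (function, gradient)
    obeying the bounds of the [n]-th stage form convex sets that decrease with
    [n]; choosing in each of them a near-minimiser of the integral of the squared
    gradient gives, by the parallelogram identity, a sequence whose gradients
    [p_n] are rapidly Cauchy in L^2 ([near_minimizers_cauchy]).  By Chebyshev's
    inequality there is a subset [B] of [A] of positive measure on which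
    [|p_(n+1) - p_n|] is summably small and [w . p_n >= c' > 0].

    Then glue.  Pass to a subsequence with [u_k] minute compared with everything
    that depends on the preceding terms, and put
    [f = u_0 chi_0 - u_1 chi_1 + u_2 chi_2 - ...], where [chi_k] is a cutoff that
    vanishes as soon as one of the preceding gradient increments is not small.
    On [B] every [chi_k] is [1], so the gradients of the partial sums alternate
    between nearly [p_0] and nearly [0], and since the tail of the series is
    negligible at suitable scales, the difference quotients of [f] along [w]
    oscillate by a fixed amount.  Off [B] the gradients [p_k] are beyond control,
    but the coefficients [chi_k] decrease, and an Abel summation
    ([alternating_sum_bounded]) bounds the gradients of all partial sums: [f] is
    Lipschitz.  This is [lipschitz_nonderivable], and it gives
    [nonderivable_of_not_arens_eells].

    It remains to pass from positive measure to almost full measure.  If [f] and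
    [g] are Lipschitz, then outside a small set [f + i g] is non-derivable
    wherever [f] or [g] is, for a suitable natural number [i]
    ([nonderivable_setU]).  Hence the sets almost exhausted by the
    non-derivability set of one Lipschitz function are stable under countable
    unions; one of maximal measure must be of full measure
    ([nonderivable_almost_everywhere]).  Inner regularity provides [K]. *)

(** * Alternating sums with decreasing coefficients *)

Section alternating_sums.
Variables (R : realType) (V : normedModType R).
Variables (a : nat -> R) (p : nat -> V) (M e : R).

Definition altsum m : R := \sum_(j < m) (-1) ^+ j * a j.
Definition altcomb m : V := \sum_(j < m) ((-1) ^+ j * a j) *: p j.

Hypotheses (a0 : a 0%N <= 1) (a_ge0 : forall j, 0 <= a j)
  (a_decr : forall j, a j.+1 <= a j) (pM : forall j, `|p j| <= M)
  (e_ge0 : 0 <= e).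


Lemma alternating_sum_itv m : 0 <= altsum m <= 1.
Proof.
suff : if odd m then a m <= altsum m <= a 0%N else 0 <= altsum m <= a 0%N - a m.
  by have := a_ge0 m; have := a0; case: odd => ? am /andP[? ?]; apply/andP; split; lra.
elim: m => [|m IH]; first by rewrite /altsum big_ord0 subrr lexx.
rewrite /altsum big_ord_recr/= -/(altsum m) -signr_odd.
have := a_decr m; have := a_ge0 m; have := a_ge0 m.+1.
by move: IH; case: odd => /= /andP[? ?] ? ? ?; apply/andP; split;
  rewrite ?expr0 ?expr1; lra.
Qed.

Hypothesis p_slow : forall j, 0 < a j.+1 -> `|p j - p j.-1| <= e * 2^-1 ^+ j.

(** Summation by parts: as long as the coefficients are positive, the vectors
    have moved by at most [2 * e] in total, so the combination is close to the
    scalar alternating sum times the current vector. *)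
Lemma alternating_sum_last m : 0 < a m ->
  `|altcomb m - altsum m *: p m.-1| <= 2 * e * (1 - 2^-1 ^+ m).
Proof.
elim: m => [|m IH] am.
  by rewrite /altcomb /altsum !big_ord0 scale0r subrr normr0 expr0 subrr mulr0.
have am0 : 0 < a m by rewrite (lt_le_trans am).
have -> : altcomb m.+1 - altsum m.+1 *: p m.+1.-1 =
    (altcomb m - altsum m *: p m.-1) - altsum m *: (p m - p m.-1).
  rewrite /altcomb /altsum !big_ord_recr/= -/(altcomb m) -/(altsum m) scalerDl scalerBr.
  by rewrite opprD opprB addrACA subrr addr0 addrA subrK.
rewrite (le_trans (ler_normB _ _))// normrZ exprS.
have /andP[s0 s1] := alternating_sum_itv m; rewrite (ger0_norm s0).
have := IH am0; have := p_slow am.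
have := normr_ge0 (p m - p m.-1).
have : 0 < (2^-1 : R) ^+ m by rewrite exprn_gt0.
set t := _ ^+ m; set q := `|_ - p _|; set r := `|_|.
by move=> *; have : altsum m * q <= q by [nra|]; lra.
Qed.

(** Once a coefficient vanishes, the later ones do too.  The last vector with a
    positive coefficient need not be close to the preceding one, but its term
    contributes at most [M]. *)
Lemma alternating_sum_bounded m : `|altcomb m| <= 2 * e + 3 * M.
Proof.
have e0 := e_ge0.
have M0 : 0 <= M by rewrite (le_trans _ (pM 0)).
have scM s q : 0 <= s <= 1 -> `|q| <= M -> `|s *: q : V| <= M.
  by move=> /andP[s0 s1] qM; rewrite normrZ ger0_norm//; have := normr_ge0 q; nra.
have half m' : 0 < (2^-1 : R) ^+ m' <= 1.
  by rewrite exprn_gt0//= exprn_ile1// ?invr_ge0// invf_le1// ler1n.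
elim: m => [|m IH]; first by rewrite /altcomb big_ord0 normr0; lra.
have [am1|] := ltP 0 (a m.+1).
  rewrite -(subrK (altsum m.+1 *: p m) (altcomb m.+1)).
  rewrite (le_trans (ler_normD _ _))//.
  have /= := alternating_sum_last am1.
  have := scM _ _ (alternating_sum_itv m.+1) (pM m).
  have /andP[] := half m.+1; set t := _ ^+ m.+1 => *.
  have : 2 * e * (1 - t) <= 2 * e by nra.
  lra.
move=> am1; have [am|am] := ltP 0 (a m); last first.
  have am0 : a m = 0 by apply/eqP; rewrite eq_le am a_ge0.
  by rewrite /altcomb big_ord_recr/= am0 mulr0 scale0r addr0.
have -> : altcomb m.+1 = (altcomb m - altsum m *: p m.-1) + altsum m *: p m.-1
     + ((-1) ^+ m * a m) *: p m.
  by rewrite /altcomb big_ord_recr/= subrK.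
have := scM _ _ (alternating_sum_itv m) (pM m.-1).
have a01 j : a j <= 1.
  by elim: j => // j; exact/le_trans/a_decr.
have : `|((-1) ^+ m * a m) *: p m| <= M.
  rewrite -scalerA normrZ normrX normrN1 expr1n mul1r scM//.
  by rewrite a_ge0 a01.
have /= := alternating_sum_last am.
have /andP[] := half m; set t := _ ^+ m => t0 t1 h1 h2 h3.
have : 2 * e * (1 - t) <= 2 * e by nra.
move=> h4; rewrite (le_trans (ler_normD _ _))//.
have := ler_normD (altcomb m - altsum m *: p m.-1) (altsum m *: p m.-1).
lra.
Qed.

End alternating_sums.

(** * The Euclidean pairing and the sup norm *)

Section euclidean_bounds.
Variables (R : realType) (d : nat).
Implicit Types (u v w x y : 'rV[R]_d).

Lemma dotpC u v : dotp u v = dotp v u.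
Proof. by apply: eq_bigr => i _; rewrite mulrC. Qed.

Lemma dotpDl u v w : dotp (u + v) w = dotp u w + dotp v w.
Proof.
by rewrite /dotp -big_split; apply: eq_bigr => i _; rewrite mxE mulrDl.
Qed.

Lemma dotpZl k u w : dotp (k *: u) w = k * dotp u w.
Proof.
by rewrite /dotp mulr_sumr; apply: eq_bigr => i _; rewrite mxE mulrA.
Qed.

Lemma dotpZr k u w : dotp u (k *: w) = k * dotp u w.
Proof. by rewrite dotpC dotpZl dotpC. Qed.

Lemma dotpNl u w : dotp (- u) w = - dotp u w.
Proof. by rewrite -scaleN1r dotpZl mulN1r. Qed.

Lemma dotpBl u v w : dotp (u - v) w = dotp u w - dotp v w.
Proof. by rewrite dotpDl dotpNl. Qed.

Lemma dotp0l w : dotp 0 w = 0.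
Proof. by rewrite -(scale0r 0) dotpZl mul0r. Qed.

Lemma dotp_ge0 u : 0 <= dotp u u.
Proof. by apply: sumr_ge0 => i _; rewrite -expr2 sqr_ge0. Qed.

Lemma coord_le_norm u i : `|u 0 i| <= `|u|.
Proof.
by rewrite [leRHS]/Num.Def.normr /= mx_normrE; apply/bigmax_geP; right; exists (0, i).
Qed.

Lemma norm_le_coord u (M : R) : 0 <= M -> (forall i, `|u 0 i| <= M) -> `|u| <= M.
Proof.
move=> M0 uM; rewrite [leLHS]/Num.Def.normr /= mx_normrE bigmax_le// => -[i j] _ /=.
by rewrite ord1.
Qed.

Lemma dotp_le u v : `|dotp u v| <= d%:R * (`|u| * `|v|).
Proof.
rewrite (le_trans (ler_norm_sum _ _ _))//.
rewrite (le_trans (ler_sum _ (G := fun=> `|u| * `|v|) _))//.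
  by move=> i _; rewrite normrM ler_pM// coord_le_norm.
by rewrite sumr_const card_ord mulr_natl.
Qed.

Lemma coord_le_enorm u i : `|u 0 i| <= enorm u.
Proof.
rewrite -sqrtr_sqr ler_wsqrtr// expr2 /dotp (bigD1 i)//= lerDl.
by apply: sumr_ge0 => j _; rewrite -expr2 sqr_ge0.
Qed.

Lemma norm_le_enorm u : `|u| <= enorm u.
Proof. by rewrite norm_le_coord ?sqrtr_ge0// => i; exact: coord_le_enorm. Qed.

(** The segment from [x] to [y] is divided into pieces no longer than [r]. *)
Lemma lipschitz_of_local (f : 'rV[R]_d -> R) (r L : R) : 0 < r ->
  (forall x y, `|y - x| <= r -> `|f y - f x| <= L * `|y - x|) ->
  forall x y, `|f y - f x| <= L * `|y - x|.
Proof.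
move=> r0 fL x y.
have [N Nr] : exists N : nat, `|y - x| <= N.+1%:R * r.
  exists (Num.truncn (`|y - x| / r)); rewrite -ler_pdivrMr//.
  by rewrite ltW// truncnS_gt.
pose z k := x + (k%:R / N.+1%:R : R) *: (y - x).
have zS k : z k.+1 - z k = N.+1%:R^-1 *: (y - x).
  rewrite /z opprD addrACA subrr add0r -scalerBl -mulrBl -natr1.
  by rewrite addrAC subrr add0r mul1r.
have Ngt0 : 0 < N.+1%:R :> R by rewrite ltr0n.
have step k : `|f (z k) - f x| <= k%:R * (L * `|y - x| / N.+1%:R).
  elim: k => [|k IH].
    by rewrite /z mul0r scale0r addr0 subrr normr0 mul0r.
  rewrite -(subrK (f (z k)) (f (z k.+1))) -addrA (le_trans (ler_normD _ _))//.
  rewrite -(natr1 k) mulrDl mul1r [leRHS]addrC lerD//.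
  have zSn : `|z k.+1 - z k| = `|y - x| / N.+1%:R.
    by rewrite zS normrZ ger0_norm ?invr_ge0 ?ltW// mulrC.
  rewrite -[leRHS]mulrA -zSn; apply: fL.
  by rewrite zSn ler_pdivrMr// mulrC.
have := step N.+1; rewrite /z divff ?gt_eqF// scale1r subrKC.
by rewrite mulrC divfK// gt_eqF.
Qed.

End euclidean_bounds.

Section clip.
Variable R : realType.
Implicit Types s t : R.

Definition clip t : R := Num.max 0 (Num.min 1 t).

Lemma clip_itv t : 0 <= clip t <= 1.
Proof. by rewrite /clip le_max lexx/= ge_max ler01 ge_min lexx. Qed.

Lemma clip_lip s t : `|clip s - clip t| <= `|s - t|.
Proof.
have h1 := ler_norm (s - t); have := ler_norm (t - s); rewrite distrC => h2.
have h3 := normr_ge0 (s - t).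
rewrite /clip ler_norml; apply/andP.
by case: (leP 1 s) => ?; case: (leP 1 t) => ?; rewrite ?(max_r ler01);
  case: (leP 0 s) => ?; case: (leP 0 t) => ?; split; lra.
Qed.

Lemma clip_le0 t : t <= 0 -> clip t = 0.
Proof. by move=> t0; apply/max_idPl; rewrite ge_min t0 orbT. Qed.

Lemma clip_ge1 t : 1 <= t -> clip t = 1.
Proof. by move=> t1; rewrite /clip (min_idPl t1) max_r. Qed.

End clip.

(** * The glued series *)

Section cutoffs.
Variables (R : realType) (d : nat).
Variables (r e : R) (C : nat -> R) (p : nat -> 'rV[R]_d -> 'rV[R]_d).
Implicit Types x y : 'rV[R]_d.

(** The [j]-th gate is open, with value [1], where the increment of the
    gradients at step [j] is at most [e / 2 ^+ j], and closed, with value [0],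
    where it exceeds twice that. *)
Definition gate j x : R := clip (2 - `|p j x - p j.-1 x| * (2 ^+ j / e)).

(** [cutoff k] involves only the gradients of index less than [k], so that the
    [k]-th function of the series can be chosen small compared with the Lipschitz
    constant of [cutoff k]. *)
Fixpoint cutoff k x : R :=
  if k is j.+1 then cutoff j x * gate j x else clip (r + 1 - `|x|).

Definition cutoff_lip k : R := 1 + \sum_(j < k) (C j + C j.-1) * (2 ^+ j / e).

Hypotheses (e_gt0 : 0 < e) (C_ge0 : forall j, 0 <= C j)
  (p_lip : forall j x y, `|p j x - p j y| <= C j * `|x - y|).

Lemma cutoff_itv k x : 0 <= cutoff k x <= 1.
Proof.
elim: k => [|k /andP[IH0 IH1]] /=; first exact: clip_itv.
have /andP[g0 g1] := clip_itv (2 - `|p k x - p k.-1 x| * (2 ^+ k / e)).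
by rewrite mulr_ge0//= mulr_ile1.
Qed.

Lemma cutoff_decr k x : cutoff k.+1 x <= cutoff k x.
Proof.
have /andP[c0 _] := cutoff_itv k x.
have /andP[_ g1] := clip_itv (2 - `|p k x - p k.-1 x| * (2 ^+ k / e)).
by rewrite /= ler_piMr.
Qed.

Lemma cutoff_slow k x : 0 < cutoff k.+1 x ->
  `|p k x - p k.-1 x| <= 2 * e * 2^-1 ^+ k.
Proof.
move=> /= ck; rewrite leNgt; apply/negP => pk; move: ck.
rewrite /gate clip_le0 ?mulr0 ?ltxx// subr_le0 mulrA ler_pdivlMr//.
by rewrite -ler_pdivrMr ?exprn_gt0// -exprVn ltW.
Qed.

Lemma cutoff_supp k x : r + 1 <= `|x| -> cutoff k x = 0.
Proof.
by move=> rx; elim: k => [|k /= ->]; rewrite /= ?mul0r// clip_le0// subr_le0.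
Qed.

Lemma cutoff_eq1 k x : `|x| <= r ->
  (forall j, `|p j x - p j.-1 x| <= e * 2^-1 ^+ j) -> cutoff k x = 1.
Proof.
move=> xr px; elim: k => [|k /= ->]; first by rewrite /= clip_ge1//; lra.
rewrite mul1r /gate clip_ge1// lerBrDr -lerBrDl (_ : 2 - 1 = 1); last by lra.
by rewrite mulrA ler_pdivrMr// mul1r -ler_pdivlMr ?exprn_gt0// -exprVn.
Qed.

Lemma gate_lipschitz j x y :
  `|gate j x - gate j y| <= (C j + C j.-1) * (2 ^+ j / e) * `|x - y|.
Proof.
rewrite (le_trans (clip_lip _ _))//.
have K0 : 0 <= 2 ^+ j / e by rewrite mulr_ge0 ?exprn_ge0// invr_ge0 ltW.
set K := 2 ^+ j / e in K0 *; set a := `|p j x - _|; set b := `|p j y - _|.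
rewrite (_ : _ - _ = (b - a) * K); last by ring.
rewrite normrM (ger0_norm K0) mulrAC ler_wpM2r// distrC.
rewrite (le_trans (ler_dist_dist _ _))// opprD addrACA -opprD.
by rewrite (le_trans (ler_normB _ _))// mulrDl lerD.
Qed.

Lemma cutoff_lip_ge0 k : 0 <= cutoff_lip k.
Proof.
rewrite addr_ge0// sumr_ge0// => j _.
by rewrite mulr_ge0 ?addr_ge0// mulr_ge0 ?exprn_ge0// invr_ge0 ltW.
Qed.

Lemma cutoff_lipschitz k x y :
  `|cutoff k x - cutoff k y| <= cutoff_lip k * `|x - y|.
Proof.
elim: k => [|k IH] /=.
  rewrite /cutoff_lip big_ord0 addr0 mul1r (le_trans (clip_lip _ _))//.
  rewrite opprB addrC addrA subrK distrC.
  exact: ler_dist_dist.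
rewrite /cutoff_lip big_ord_recr/= addrA -/(cutoff_lip k) mulrDl.
rewrite (_ : _ - _ = gate k x * (cutoff k x - cutoff k y) +
                     cutoff k y * (gate k x - gate k y)); last by ring.
rewrite (le_trans (ler_normD _ _))// !normrM.
have /andP[g0 g1] := clip_itv (2 - `|p k x - p k.-1 x| * (2 ^+ k / e)).
have /andP[c0 c1] := cutoff_itv k y.
rewrite (ger0_norm g0) (ger0_norm c0) lerD//.
  by rewrite (le_trans _ IH)// ler_piMl.
by rewrite (le_trans _ (gate_lipschitz _ _ _))// ler_piMl.
Qed.

End cutoffs.

Section dyadic.
Variable R : realType.

Lemma half_small (K eps : R) : 0 < eps ->
  exists N, forall n, (N <= n)%N -> K * 2^-1 ^+ n <= eps.
Proof.
move=> eps0; have : geometric K 2^-1 @ \oo --> 0.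
  by apply: cvg_geometric; rewrite gtr0_norm ?invf_lt1// ltr1n.
move=> /cvgr0Pnorm_le/(_ _ eps0)[N _ NK]; exists N => n /NK /=.
exact/le_trans/ler_norm.
Qed.

Lemma cvg_of_dyadic_tail (g : nat -> R) (K : R) :
  (forall m k, (m <= k)%N -> `|g k - g m| <= K * 2^-1 ^+ m) ->
  forall m, `|limn g - g m| <= K * 2^-1 ^+ m.
Proof.
move=> gK; have gl : cvgn g.
  apply: cauchy_cvg; apply: cauchy_exP => eps eps0.
  have [N NK] := half_small K (divr_gt0 eps0 (ltr0n _ 2)).
  exists (g N); exists N => // k /= Nk; rewrite /ball/= distrC.
  rewrite (le_lt_trans (gK _ _ Nk))// (le_lt_trans (NK _ _))//.
  by rewrite ltr_pdivrMr// ltr_pMr// ltr1n.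
move=> m; apply/ler_addgt0Pl => eps eps0.
have /cvgrPdist_le/(_ _ eps0)[N _ Nl] := gl.
rewrite -(subrK (g (maxn N m)) (limn g)) -addrA (le_trans (ler_normD _ _))//.
by rewrite lerD// ?gK ?leq_maxr//; apply: Nl; rewrite /= leq_maxl.
Qed.

End dyadic.

Section dyadic_quotients.
Variables (R : realType) (d : nat).

Definition dyadic_quotient (f : 'rV[R]_d -> R) (v x : 'rV[R]_d) (k : nat) : R :=
  (f (x + 2^-1 ^+ k *: v) - f x) / 2^-1 ^+ k.

End dyadic_quotients.

Section gliding_sum.
Variables (R : realType) (d : nat) (r e M : R) (C b : nat -> R) (n : nat -> nat).
Variables (u : nat -> 'rV[R]_d -> R) (p : nat -> 'rV[R]_d -> 'rV[R]_d).
Implicit Types x y w : 'rV[R]_d.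
Hypotheses (r_ge0 : 0 <= r) (e_gt0 : 0 < e) (C_ge0 : forall j, 0 <= C j)
  (p_lip : forall j x y, `|p j x - p j y| <= C j * `|x - y|)
  (u_taylor : forall j x y,
     `|u j y - u j x - dotp (p j x) (y - x)| <= C j * `|y - x| ^+ 2)
  (pM : forall j x, `|p j x| <= M)
  (u_small : forall j x, `|x| <= r + 2 -> `|u j x| <= b j)
  (b_cutoff : forall j, b j * cutoff_lip e C j <= e * 2^-1 ^+ j)
  (n_ge : forall m, (m <= n m)%N)
  (n_taylor : forall m, (\sum_(j < m) C j) * 2^-1 ^+ n m <= e)
  (b_scale : forall m j, (m <= j)%N -> b j <= e * 2^-1 ^+ j * 2^-1 ^+ n m).

Let chi := cutoff r e p.

Definition gsum m x : R := \sum_(j < m) (-1) ^+ j * (chi j x * u j x).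
Definition gsum_grad m x : 'rV[R]_d := altcomb (chi ^~ x) (p ^~ x) m.

Let half_gt0 k : 0 < (2^-1 : R) ^+ k. Proof. by rewrite exprn_gt0. Qed.
Let half_le1 k : (2^-1 : R) ^+ k <= 1.
Proof. by rewrite exprn_ile1// invf_le1// ler1n. Qed.

(** The cutoff is merely Lipschitz: its variation, times the minute function
    [u j], goes into the error term that is linear in [|y - x|]. *)
Lemma gsum_term_taylor j x y : `|y - x| <= 1 ->
  `|chi j y * u j y - chi j x * u j x - chi j x * dotp (p j x) (y - x)|
    <= C j * `|y - x| ^+ 2 + e * 2^-1 ^+ j * `|y - x|.
Proof.
move=> yx.
rewrite (_ : _ - _ = chi j x * (u j y - u j x - dotp (p j x) (y - x))
  + (chi j y - chi j x) * u j y); last by ring.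
rewrite (le_trans (ler_normD _ _))// !normrM lerD//.
  have /andP[c0 c1] := cutoff_itv r e p j x.
  by rewrite (ger0_norm c0) (le_trans _ (u_taylor _ _ _))// ler_piMl.
have [yr|yr] := leP `|y| (r + 2).
  have /= cl := @cutoff_lipschitz _ _ r e C p e_gt0 p_lip j y x.
  rewrite (le_trans (ler_wpM2r _ cl))// mulrAC ler_wpM2r//.
  rewrite (le_trans _ (b_cutoff j))// mulrC ler_wpM2r ?u_small//.
  exact: cutoff_lip_ge0.
have xr : r + 1 <= `|x|.
  by have := ler_normD (y - x) x; rewrite subrK; move: yx yr; lra.
rewrite /chi !cutoff_supp//; last by rewrite (le_trans _ (ltW yr))// lerD2l ler1n.
by rewrite subrr normr0 mul0r mulr_ge0// mulr_ge0// ltW.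
Qed.

Lemma gsum_taylor m x y : `|y - x| <= 1 ->
  `|gsum m y - gsum m x - dotp (gsum_grad m x) (y - x)|
    <= (\sum_(j < m) C j) * `|y - x| ^+ 2 + 2 * e * `|y - x|.
Proof.
move=> yx; have yx0 := normr_ge0 (y - x).
suff : `|gsum m y - gsum m x - dotp (gsum_grad m x) (y - x)|
    <= (\sum_(j < m) C j) * `|y - x| ^+ 2 + 2 * e * (1 - 2^-1 ^+ m) * `|y - x|.
  move/le_trans; apply; rewrite lerD2l ler_wpM2r// ler_piMr//.
  by rewrite mulr_ge0// ltW.
elim: m => [|m IH].
  rewrite /gsum /gsum_grad /altcomb !big_ord0 dotp0l !subr0 normr0.
  by rewrite expr0 subrr mulr0 !mul0r addr0.
rewrite /gsum /gsum_grad /altcomb !big_ord_recr/= -/(gsum m x) -/(gsum m y).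
rewrite -/(altcomb _ _ m) -/(gsum_grad m x) dotpDl dotpZl.
rewrite (_ : _ - _ = (gsum m y - gsum m x - dotp (gsum_grad m x) (y - x)) +
  (-1) ^+ m * (chi m y * u m y - chi m x * u m x
    - chi m x * dotp (p m x) (y - x))); last by ring.
rewrite (le_trans (ler_normD _ _))//.
rewrite [`|_ * (_ - _)|]normrM normrX normrN1 expr1n mul1r [2^-1 ^+ m.+1]exprS.
have := gsum_term_taylor m yx.
move: IH; set t : R := 2^-1 ^+ m; set s : R := \sum_(_ < _) _.
set z : R := `|y - x|; set q : R := `|_ - _|; set q' : R := `|_ - _|.
lra.
Qed.

Let slope : R := d%:R * (4 * e + 3 * M) + 2 * e + 1.

Lemma gsum_grad_le m x : `|gsum_grad m x| <= 4 * e + 3 * M.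
Proof.
rewrite (_ : 4 * e = 2 * (2 * e)); last by ring.
apply: alternating_sum_bounded => //.
- by have /andP[] := cutoff_itv r e p 0 x.
- by move=> j; have /andP[] := cutoff_itv r e p j x.
- by move=> j; exact: cutoff_decr.
- by rewrite mulr_ge0// ltW.
- by move=> j; exact: cutoff_slow.
Qed.

(** The radius on which the quadratic error is harmless depends on [m], the
    slope does not. *)
Lemma gsum_lipschitz m x y : `|gsum m y - gsum m x| <= slope * `|y - x|.
Proof.
have C0 : 0 <= \sum_(j < m) C j by exact: sumr_ge0.
set K := \sum_(j < m) C j in C0.
apply: (@lipschitz_of_local _ _ _ (1 + K)^-1).
  by rewrite invr_gt0 ltr_pwDl.
move=> {}x {}y yx.
have K1 : 0 < 1 + K by rewrite ltr_pwDl.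
have yx1 : `|y - x| <= 1 by rewrite (le_trans yx)// invf_le1// lerDl.
have KK : K * `|y - x| <= 1.
  rewrite (le_trans (ler_wpM2l C0 yx))// ler_pdivrMr// mul1r.
  by rewrite lerDr.
have := gsum_taylor m yx1; rewrite -/K expr2 mulrA => tay.
have := dotp_le (gsum_grad m x) (y - x) => dl.
have := gsum_grad_le m x => gl.
have yx0 := normr_ge0 (y - x).
have : d%:R * (`|gsum_grad m x| * `|y - x|) <=
       d%:R * ((4 * e + 3 * M) * `|y - x|) by rewrite ler_wpM2l// ler_wpM2r.
have : K * `|y - x| * `|y - x| <= 1 * `|y - x| by rewrite ler_wpM2r.
have := ler_normD (gsum m y - gsum m x - dotp (gsum_grad m x) (y - x))
  (dotp (gsum_grad m x) (y - x)).
rewrite subrK /slope; lra.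
Qed.

Let b_ge0 j : 0 <= b j.
Proof. by rewrite (le_trans _ (u_small j (x := 0) _)) ?normr0// addr_ge0. Qed.

Lemma gsum_tail_small m k x : (m <= k)%N ->
  `|gsum k x - gsum m x| <= 2 * e * 2^-1 ^+ n m * 2^-1 ^+ m.
Proof.
move=> mk.
suff : `|gsum k x - gsum m x| <= 2 * e * 2^-1 ^+ n m * (2^-1 ^+ m - 2^-1 ^+ k).
  move/le_trans; apply; rewrite ler_wpM2l//.
    by rewrite mulr_ge0// ?(ltW (half_gt0 _))// mulr_ge0// ltW.
  by rewrite lerBlDr lerDl ltW.
elim: k mk => [|k IH].
  by rewrite leqn0 => /eqP ->; rewrite !subrr normr0 mulr0.
rewrite leq_eqVlt ltnS => /predU1P[<-|mk]; first by rewrite !subrr normr0 mulr0.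
have tk : `|chi k x * u k x| <= b k.
  have [xr|xr] := leP `|x| (r + 2).
    have /andP[c0 c1] := cutoff_itv r e p k x.
    by rewrite normrM (ger0_norm c0) (le_trans _ (u_small _ xr))// ler_piMl.
  rewrite /chi cutoff_supp ?mul0r ?normr0//.
  by rewrite (le_trans _ (ltW xr))// lerD2l ler1n.
rewrite /gsum big_ord_recr/= -/(gsum k x) addrAC.
rewrite (le_trans (ler_normD _ _))//.
rewrite [`|_ * (_ * _)|]normrM normrX normrN1 expr1n mul1r [2^-1 ^+ k.+1]exprS.
by have := IH mk; have := b_scale mk; move: tk; rewrite -!mulrA => *; nra.
Qed.

Definition gsum_lim x : R := limn (gsum ^~ x).

Lemma gsum_lim_near m x :
  `|gsum_lim x - gsum m x| <= 2 * e * 2^-1 ^+ n m.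
Proof.
apply/ler_addgt0Pl => eps eps0.
have K0 k : 0 <= 2 * e * 2^-1 ^+ n k.
  by rewrite mulr_ge0// ?(ltW (half_gt0 _))// mulr_ge0// ltW.
have lim_near := @cvg_of_dyadic_tail _ (gsum ^~ x) (2 * e) _.
have [N NK] := half_small (2 * e) eps0.
rewrite -(subrK (gsum (maxn N m) x) (gsum_lim x)) -addrA.
rewrite (le_trans (ler_normD _ _))// lerD//.
  rewrite (le_trans (lim_near _ _))// ?NK ?leq_maxl// => i k ik.
  rewrite (le_trans (gsum_tail_small _ ik))// ler_wpM2r ?(ltW (half_gt0 _))//.
  by rewrite ler_piMr// mulr_ge0// ltW.
by rewrite (le_trans (gsum_tail_small _ (leq_maxr _ _)))// ler_piMr.
Qed.

Lemma gsum_lim_lipschitz : lipschitz_fun gsum_lim.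
Proof.
have slope0 : 0 <= slope.
  have M0 : 0 <= M by rewrite (le_trans _ (pM 0 0)).
  by rewrite !addr_ge0// ?mulr_ge0 ?addr_ge0 ?mulr_ge0// ?ltW.
exists slope => x y; apply: (@le_trans _ _ (slope * `|x - y|)); last first.
  by rewrite ler_wpM2l// norm_le_enorm.
apply/ler_addgt0Pl => eps eps0.
have [N NK] := half_small (4 * e) eps0.
have := NK _ (n_ge N); have := gsum_lim_near N x; have := gsum_lim_near N y.
have := gsum_lipschitz N y x; set t := _ ^+ _.
rewrite [`|gsum_lim y - _|]distrC.
rewrite [gsum_lim x - gsum_lim y](_ : _ = (gsum_lim x - gsum N x) +
  ((gsum N x - gsum N y) + (gsum N y - gsum_lim y))); last by ring.
have := ler_normD (gsum N x - gsum N y) (gsum N y - gsum_lim y).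
set q := _ + (gsum N y - _); have := ler_normD (gsum_lim x - gsum N x) q.
lra.
Qed.

(** The scale [2^-1 ^+ n m] is small enough for the partial sum of index [m] to
    be nearly affine, and large compared with the tail of the series. *)
Lemma gsum_quotient m x w : `|w| <= 1 ->
  `|dyadic_quotient gsum_lim w x (n m) - dotp (gsum_grad m x) w| <= 7 * e.
Proof.
rewrite /dyadic_quotient => w1; set h := _ ^+ _; have h0 : 0 < h := half_gt0 _.
have h1 : h <= 1 := half_le1 _.
have yx : `|x + h *: w - x| <= h.
  by rewrite addrAC subrr add0r normrZ gtr0_norm// ler_piMr// ltW.
have := gsum_taylor m (le_trans yx h1).
rewrite {2}[x + _]addrC addrK dotpZr.
set y := x + h *: w in yx *; set D := dotp _ _.
have := gsum_lim_near m y; have := gsum_lim_near m x; rewrite -/h => fx fy tay.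
have C0 : 0 <= \sum_(j < m) C j by exact: sumr_ge0.
have Ch := n_taylor m; rewrite -/h in Ch.
have t2 : (\sum_(j < m) C j) * `|y - x| ^+ 2 <= e * h.
  rewrite (@le_trans _ _ ((\sum_(j < m) C j) * h ^+ 2))//.
    by rewrite ler_wpM2l// lerXn2r// nnegrE// ltW.
  by rewrite expr2 mulrA ler_wpM2r// ltW.
have t3 : 2 * e * `|y - x| <= 2 * e * h.
  by rewrite ler_wpM2l// mulr_ge0// ltW.
rewrite (_ : _ - D = (gsum_lim y - gsum_lim x - h * D) / h); last first.
  by rewrite [in RHS]mulrBl [h * D]mulrC mulfK// gt_eqF.
rewrite normrM normfV (gtr0_norm h0) ler_pdivrMr//.
rewrite [X in `|X|](_ : _ = (gsum_lim y - gsum m y) +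
  ((gsum m y - gsum m x - h * D) - (gsum_lim x - gsum m x))); last by ring.
rewrite (le_trans (ler_normD _ _))//.
have := ler_normB (gsum m y - gsum m x - h * D) (gsum_lim x - gsum m x).
lra.
Qed.

(** Where all cutoffs are [1], the scalar alternating sum is [1] or [0] according
    to the parity of [m]; summation by parts then leaves [p m.-1 x] or [0] up to
    a small error. *)
Lemma gsum_grad_alternates m x w (c : R) : `|x| <= r -> `|w| <= 1 ->
  (forall k, `|p k x - p k.-1 x| <= e * 2^-1 ^+ k) ->
  (forall k, c <= dotp w (p k x)) ->
  if odd m then c - d%:R * (4 * e) <= dotp (gsum_grad m x) w
  else dotp (gsum_grad m x) w <= d%:R * (4 * e).
Proof.
move=> xr w1 px wp.
have chi1 k : chi k x = 1 by apply: cutoff_eq1.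
have alt : altsum (chi ^~ x) m = (odd m)%:R.
  elim: m => [|m IH]; first by rewrite /altsum big_ord0.
  rewrite /altsum big_ord_recr/= -/(altsum (chi ^~ x) m) IH chi1 mulr1 -signr_odd.
  by case: odd => /=; rewrite ?expr1 ?expr0 ?subrr ?add0r.
have := @alternating_sum_last _ _ (chi ^~ x) (p ^~ x) (2 * e).
move=> /(_ _ _ _ _ m) alts.
have {alts} close : `|gsum_grad m x - (odd m)%:R *: p m.-1 x| <= 4 * e.
  rewrite -alt (_ : 4 * e = 2 * (2 * e)); last by ring.
  rewrite (le_trans (alts _ _ _ _ _))//.
  - by rewrite chi1.
  - by move=> j; rewrite chi1.
  - by move=> j; rewrite !chi1.
  - by move=> j; exact: cutoff_slow.
  - by rewrite chi1.
  - by rewrite ler_piMr// !mulr_ge0// ltW.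
have := dotp_le (gsum_grad m x - (odd m)%:R *: p m.-1 x) w.
have : d%:R * (`|gsum_grad m x - (odd m)%:R *: p m.-1 x| * `|w|) <=
    d%:R * (4 * e).
  by rewrite ler_wpM2l// (le_trans _ close)// ler_piMr.
move=> h1 /le_trans/(_ h1); rewrite dotpBl ler_norml dotpZl => /andP[lo hi].
have := wp m.-1; rewrite dotpC; move: lo hi.
by case: odd => /=; rewrite ?mul1r ?mul0r ?subr0 => *; lra.
Qed.

(** Beyond any [N], the scale of index [2 N] sees a slope near [0] and the one
    of index [2 N + 1] a slope near [c]. *)
Lemma gsum_lim_diverges x w (c : R) : `|x| <= r -> `|w| <= 1 ->
  (forall k, `|p k x - p k.-1 x| <= e * 2^-1 ^+ k) ->
  (forall k, c <= dotp w (p k x)) ->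
  (8 * d%:R + 16) * e <= c ->
  ~ cvgn (dyadic_quotient gsum_lim w x).
Proof.
move=> xr w1 px wp ec; set q := dyadic_quotient _ _ _; move=> /cvgrPdist_lt/(_ _ e_gt0).
move=> [N _ qN].
have qm m : (N <= m)%N -> `|limn q - dotp (gsum_grad m x) w| < 8 * e.
  move=> Nm; have /= := qN (n m) (leq_trans Nm (n_ge m)).
  have := gsum_quotient m x w1; rewrite -/(q (n m)).
  have := ler_normD (limn q - q (n m)) (q (n m) - dotp (gsum_grad m x) w).
  by rewrite addrA subrK; lra.
have := gsum_grad_alternates N.*2 xr w1 px wp.
have := gsum_grad_alternates N.*2.+1 xr w1 px wp.
rewrite /= odd_double/=.
have Nd : (N <= N.*2)%N by rewrite -addnn leq_addr.
have := qm _ Nd; have := qm N.*2.+1 (leqW Nd).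
rewrite !ltr_norml; move=> /andP[? ?] /andP[? ?].
lra.
Qed.

End gliding_sum.

(** Dependent choice with memory: the terms already chosen are kept in a list,
    and [Q nu k] reads [nu] only below [k]. *)
Lemma history_choice (Q : (nat -> nat) -> nat -> nat -> Prop) :
  (forall nu k, exists n, Q nu k n) ->
  (forall nu nu' k n, (forall j, (j < k)%N -> nu j = nu' j) ->
     Q nu k n -> Q nu' k n) ->
  exists nu, forall k, Q nu k (nu k).
Proof.
move=> ex ext; pose g nu k := projT1 (cid (ex nu k)).
have gQ nu k : Q nu k (g nu k) by rewrite /g; case: cid.
pose s := fix s k := if k is j.+1 then rcons (s j) (g (nth 0%N (s j)) j) else [::].
have ss k : size (s k) = k by elim: k => //= k IH; rewrite size_rcons IH.
have sE j k : (j < k)%N -> nth 0%N (s k) j = nth 0%N (s j.+1) j.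
  elim: k => // k IH; rewrite ltnS leq_eqVlt => /predU1P[->//|jk].
  by rewrite [s k.+1]/= nth_rcons ss jk IH.
exists (fun k => nth 0%N (s k.+1) k) => k.
apply: (ext (nth 0%N (s k))) => [j jk|]; first exact: sE.
by rewrite /= nth_rcons ss ltnn eqxx; exact: gQ.
Qed.

Section nonderivable.
Variables (R : realType) (d : nat) (r e M : R) (C : nat -> R).
Variables (u : nat -> 'rV[R]_d -> R) (p : nat -> 'rV[R]_d -> 'rV[R]_d).
Implicit Types x y w : 'rV[R]_d.

Lemma steps_to_tail (q : nat -> 'rV[R]_d) :
  (forall k, `|q k.+1 - q k| <= e * 2^-1 ^+ k.+2) ->
  forall k m l, (k <= m)%N -> (k <= l)%N -> `|q m - q l| <= e * 2^-1 ^+ k.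
Proof.
move=> qS.
have e0 : 0 <= e.
  by have := le_trans (normr_ge0 _) (qS 0%N); rewrite pmulr_lge0// exprn_gt0.
have tail k m : (k <= m)%N -> `|q m - q k| <= e * (2^-1 ^+ k.+1 - 2^-1 ^+ m.+1).
  elim: m => [|m IH]; first by rewrite leqn0 => /eqP ->; rewrite !subrr normr0 mulr0.
  rewrite leq_eqVlt ltnS => /predU1P[<-|km]; first by rewrite !subrr normr0 mulr0.
  rewrite -(subrK (q m) (q m.+1)) -addrA (le_trans (ler_normD _ _))//.
  have := IH km; have := qS m; rewrite [2^-1 ^+ m.+2]exprS; lra.
move=> k m l km kl.
have half0 j : 0 <= e * 2^-1 ^+ j.+1 by rewrite mulr_ge0// exprn_ge0.
rewrite -(subrK (q k) (q m)) -addrA (le_trans (ler_normD _ _))//.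
have := tail _ _ km; have := tail _ _ kl; rewrite [`|q k - q l|]distrC.
have := half0 m; have := half0 l.
rewrite [2^-1 ^+ k.+1]exprS; lra.
Qed.

(** From a sequence tending to [0] uniformly on a ball, extract a subsequence so
    sparse that the glued series converges to the desired function. *)
Lemma lipschitz_nonderivable : 0 <= r -> 0 < e -> (forall j, 0 <= C j) ->
  (forall j x y, `|p j x - p j y| <= C j * `|x - y|) ->
  (forall j x y,
     `|u j y - u j x - dotp (p j x) (y - x)| <= C j * `|y - x| ^+ 2) ->
  (forall j x, `|p j x| <= M) ->
  (forall delta : R, 0 < delta -> exists N, forall n x, (N <= n)%N ->
     `|x| <= r + 2 -> `|u n x| <= delta) ->
  exists f, lipschitz_fun f /\ forall x w (c : R), `|x| <= r -> `|w| <= 1 ->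
    (forall k, `|p k.+1 x - p k x| <= e * 2^-1 ^+ k.+2) ->
    (forall k, c <= dotp w (p k x)) -> (8 * d%:R + 16) * e <= c ->
    ~ cvgn (dyadic_quotient f w x).
Proof.
move=> r0 e0 C0 plip utay pM usmall.
have half01 k : 0 < (2^-1 : R) ^+ k <= 1.
  by rewrite exprn_gt0//= exprn_ile1// ?invr_ge0// invf_le1// ler1n.
pose nf (K : R) := projT1 (cid (half_small K e0)).
have nfP K n : (nf K <= n)%N -> K * 2^-1 ^+ n <= e by rewrite /nf; case: cid => N /= + Nn; apply.
pose n (nu : nat -> nat) m := maxn m (nf (\sum_(j < m) C (nu j))).
pose L nu k := cutoff_lip e (C \o nu) k.
have L1 nu k : 1 <= L nu k.
  rewrite lerDl sumr_ge0// => j _; rewrite mulr_ge0 ?addr_ge0 ?C0//.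
  by rewrite mulr_ge0 ?exprn_ge0// invr_ge0 ltW.
(* The size required of the k-th chosen function: smaller than the inverse of
   the Lipschitz constant of its cutoff, and than all scales n used so far, whose
   product is 2^-1 to the sum of their exponents. *)
pose b nu k := e * 2^-1 ^+ k * (2^-1 ^+ (\sum_(m < k.+1) n nu m) / L nu k).
have b0 nu k : 0 < b nu k.
  have /andP[h0 _] := half01 k.
  have /andP[h1 _] := half01 (\sum_(m < k.+1) n nu m).
  by rewrite !mulr_gt0// invr_gt0 (lt_le_trans _ (L1 _ _)).
pose Q nu k j := (k < j)%N /\ forall x, `|x| <= r + 2 -> `|u j x| <= b nu k.
have [nu nuQ] : exists nu, forall k, Q nu k (nu k).
  apply: history_choice => [nu k|nu nu' k j nunu' [kj uj]].
    have [N NP] := usmall _ (b0 nu k); exists (maxn N k.+1).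
    by split => [|x]; [rewrite leq_maxr|apply: NP; rewrite leq_maxl].
  suff bE : b nu k = b nu' k by split=> // x xr; rewrite -bE uj.
  congr (_ * (_ / _)).
    congr (_ ^+ _); apply: eq_bigr => -[m /= mk] _; congr (maxn _ (nf _)).
    by apply: eq_bigr => -[i /= im] _; rewrite nunu'// (leq_trans im).
  congr (_ + _); apply: eq_bigr => -[i /= ik] _.
  by rewrite !nunu'// (leq_ltn_trans (leq_pred _)).
exists (gsum_lim r e (u \o nu) (p \o nu)).
have plip' j x y : `|(p \o nu) j x - (p \o nu) j y| <= (C \o nu) j * `|x - y|.
  exact: plip.
have utay' j x y : `|(u \o nu) j y - (u \o nu) j x - dotp ((p \o nu) j x) (y - x)|
    <= (C \o nu) j * `|y - x| ^+ 2 by exact: utay.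
have usmall' j x : `|x| <= r + 2 -> `|(u \o nu) j x| <= b nu j.
  by case: (nuQ j) => _; apply.
have bcut j : b nu j * cutoff_lip e (C \o nu) j <= e * 2^-1 ^+ j.
  rewrite /b -!mulrA -/(L nu j) mulVf ?mulr1; last by rewrite gt_eqF// (lt_le_trans _ (L1 _ _)).
  have /andP[h0 _] := half01 j.
  have /andP[_ h1] := half01 (\sum_(m < j.+1) n nu m).
  by rewrite mulrA ler_piMr// mulr_ge0// ltW.
have nge m : (m <= n nu m)%N by rewrite leq_maxl.
have ntay m : (\sum_(j < m) (C \o nu) j) * 2^-1 ^+ n nu m <= e.
  by apply: nfP; rewrite leq_maxr.
have bscale m j : (m <= j)%N -> b nu j <= e * 2^-1 ^+ j * 2^-1 ^+ n nu m.
  move=> mj; rewrite ler_wpM2l//.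
    by have /andP[h0 _] := half01 j; rewrite mulr_ge0// ltW.
  have /andP[h0 _] := half01 (\sum_(m < j.+1) n nu m).
  rewrite (@le_trans _ _ (2^-1 ^+ (\sum_(m < j.+1) n nu m)))//.
    by rewrite ler_piMr ?(ltW h0)// invf_le1// (lt_le_trans _ (L1 _ _)).
  apply: ler_wiXn2l; rewrite ?invr_ge0// ?invf_le1// ?ler1n//.
  by rewrite (bigD1 (Ordinal (mj : (m < j.+1)%N)))//= leq_addr.
have C0' j : 0 <= (C \o nu) j by exact: C0.
have pM' j x : `|(p \o nu) j x| <= M by exact: pM.
split.
  exact: (@gsum_lim_lipschitz _ _ r e M (C \o nu) (b nu) (n nu)).
move=> x w c xr w1 px wp ec.
apply: (@gsum_lim_diverges _ _ r e (C \o nu) (b nu) (n nu) (u \o nu) (p \o nu)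
  r0 e0 C0' plip' utay' usmall' bcut nge ntay bscale x w c) => //; last by move=> k; exact: wp.
move=> k; have [km _] := nuQ k; have [kl _] := nuQ k.-1.
apply: (@steps_to_tail (p ^~ x) px) (ltnW km) _.
by case: k kl {km}.
Qed.

End nonderivable.

(** * Test functions have Lipschitz gradients *)

Section mean_value.
Variables (R : realType) (d : nat).
Implicit Types (x y z v a : 'rV[R]_d) (f phi : 'rV[R]_d -> R).

Lemma is_derive_line f z v (t : R) : derivable f (z + t *: v) v ->
  is_derive t 1 (fun s => f (z + s *: v)) ('D_v f (z + t *: v)).
Proof.
move=> fv.
have E : (fun h : R => h^-1 *: (((fun s => f (z + s *: v)) \o shift t) (h *: 1)
    - f (z + t *: v))) =
  (fun h : R => h^-1 *: ((f \o shift (z + t *: v)) (h *: v) - f (z + t *: v))).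
  apply/funext => h /=; congr (_ *: (f _ - _)).
  by rewrite [h *: 1]mulr1 scalerDl addrCA.
by apply: DeriveDef; rewrite /derivable /derive E.
Qed.

Lemma line_mean_value f z v (s : R) : (forall t, derivable f (z + t *: v) v) ->
  exists2 c : R, `|c| <= `|s| & f (z + s *: v) - f z = 'D_v f (z + c *: v) * s.
Proof.
move=> fv; pose g t := f (z + t *: v).
have g0 : g 0 = f z by rewrite /g scale0r addr0.
have gd (t : R) : is_derive t 1 g ('D_v f (z + t *: v)) by exact: is_derive_line.
have gc (l h : R) : {within `[l, h], continuous g}.
  by apply: derivable_within_continuous => t _; exact: ex_derive.
have [s0|s0] := leP 0 s.
  have [c] := MVT_segment s0 (fun t _ => gd t) (@gc _ _).
  rewrite in_itv/= => /andP[c0 cs] gE; exists c; first by rewrite !ger0_norm.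
  by rewrite -/(g s) -g0 gE subr0.
have [c] := MVT_segment (ltW s0) (fun t _ => gd t) (@gc _ _).
rewrite in_itv/= => /andP[cs c0] gE; exists c.
  by rewrite (ltr0_norm s0) ler0_norm// lerN2.
by rewrite -/(g s) -g0 -opprB gE sub0r mulrN opprK.
Qed.

Lemma dotp_delta a (s : R) i : dotp a (s *: delta_mx 0 i) = s * a 0 i.
Proof.
rewrite dotpZr /dotp (bigD1 i)//= big1 ?addr0 ?mxE ?eqxx ?mulr1// => j ji.
by rewrite mxE (negbTE ji) andbF mulr0.
Qed.

(** The mean value theorem applied along the path from [x] to [y] that changes
    one coordinate at a time; this path stays in the sup-norm ball about [x]
    through [y]. *)
Lemma partial_mean_value f x y a (e : R) :
  (forall z i, derivable f z (delta_mx 0 i)) ->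
  (forall z i, `|z - x| <= `|y - x| -> `|partial i f z - a 0 i| <= e) ->
  `|f y - f x - dotp a (y - x)| <= d%:R * (e * `|y - x|).
Proof.
move=> fd fa.
pose z k : 'rV[R]_d := \row_(j < d) if (j < k)%N then y 0 j else x 0 j.
have zx k : (k <= d)%N ->
    `|f (z k) - f x - dotp a (z k - x)| <= k%:R * (e * `|y - x|).
  elim: k => [_|k IH kd].
    have -> : z 0%N = x by apply/rowP => j; rewrite mxE.
    by rewrite !subrr dotpC dotp0l subrr normr0 mul0r.
  pose i := Ordinal kd; pose s := y 0 i - x 0 i.
  have zS : z k.+1 = z k + s *: delta_mx 0 i.
    apply/rowP => j; rewrite !mxE ltnS leq_eqVlt eqxx /=.
    have [->|ji] := eqVneq j i.
      by rewrite eqxx/= ltnn mulr1 /s subrKC.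
    by rewrite mulr0 addr0 (_ : (j == k :> nat) = false)//; apply/negbTE.
  have [c cs] := @line_mean_value f (z k) (delta_mx 0 i) s (fun t => fd _ i).
  rewrite -zS => fz.
  have cz : `|z k + c *: delta_mx 0 i - x| <= `|y - x|.
    apply: norm_le_coord => // j; rewrite !mxE eqxx /=.
    have [->|ji] := eqVneq j i.
      rewrite ltnn mulr1 addrAC subrr add0r (le_trans cs)//.
      by have := coord_le_norm (y - x) i; rewrite !mxE.
    rewrite mulr0 addr0; case: ifP => _; last by rewrite subrr normr0.
    by have := coord_le_norm (y - x) j; rewrite !mxE.
  have := fa _ i cz; rewrite -/(partial i f _) in fz => fc.
  rewrite [X in `|X|](_ : _ = (f (z k) - f x - dotp a (z k - x)) +
      (partial i f (z k + c *: delta_mx 0 i) - a 0 i) * s); last first.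
    have -> : f (z k.+1) = f (z k) + partial i f (z k + c *: delta_mx 0 i) * s.
      by rewrite -fz subrKC.
    have -> : dotp a (z k.+1 - x) = dotp a (z k - x) + s * a 0 i.
      by rewrite zS addrAC dotpC dotpDl dotpC [dotp (s *: _) _]dotpC dotp_delta.
    ring.
  rewrite (le_trans (ler_normD _ _))// -(natr1 k) [leRHS]mulrDl mul1r lerD ?IH 1?ltnW//.
  rewrite normrM ler_pM//.
  by have := coord_le_norm (y - x) i; rewrite !mxE.
have := zx d (leqnn d); suff -> : z d = y by [].
by apply/rowP => j; rewrite mxE ltn_ord.
Qed.

End mean_value.

Section regular_functions.
Variables (R : realType) (d : nat).
Implicit Types (x y z v a : 'rV[R]_d) (u f phi : 'rV[R]_d -> R)
  (p : 'rV[R]_d -> 'rV[R]_d).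

(** [u] is of class C^{1,1} with gradient [p].  The two inequalities are
    preserved by linear combinations, and they are all that the glued series
    uses of the regularity of its terms. *)
Definition c11 u p := exists2 C : R, 0 <= C &
  (forall x y, `|p x - p y| <= C * `|x - y|) /\
  (forall x y, `|u y - u x - dotp (p x) (y - x)| <= C * `|y - x| ^+ 2).

Lemma c11_comb (k l : R) u u' p p' : c11 u p -> c11 u' p' ->
  c11 (fun x => k * u x + l * u' x) (fun x => k *: p x + l *: p' x).
Proof.
move=> [C C0 [Cp Cu]] [D D0 [Dp Du]].
exists (`|k| * C + `|l| * D); first by rewrite addr_ge0// mulr_ge0.
split=> x y.
  rewrite opprD addrACA -!scalerBr (le_trans (ler_normD _ _))// !normrZ.
  by rewrite mulrDl -!mulrA lerD// ler_wpM2l.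
rewrite dotpDl !dotpZl (_ : _ - _ = k * (u y - u x - dotp (p x) (y - x)) +
  l * (u' y - u' x - dotp (p' x) (y - x))); last by ring.
rewrite (le_trans (ler_normD _ _))// !normrM.
by rewrite mulrDl -!mulrA lerD// ler_wpM2l.
Qed.

Lemma c11_subr_cst (c : R) u p : c11 u p -> c11 (fun x => u x - c) p.
Proof.
move=> [C C0 [Cp Cu]]; exists C => //; split=> // x y.
by rewrite opprB addrA subrK.
Qed.

Lemma iter_partial_supp phi s x :
  ~ closure [set x | phi x != 0] x -> iter_partial s phi x = 0.
Proof.
elim: s x => [|i s IH] x xK /=.
  apply/eqP/negPn/negP => phix; apply: xK; exact: subset_closure.
rewrite /partial (@near_eq_derive _ _ _ _ (cst 0)) ?derive_cst//.
have : nbhs x (~` closure [set x | phi x != 0]).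
  by apply: open_nbhs_nbhs; split => //; exact/closed_openC/closed_closure.
by apply: filterS => z /IH.
Qed.

Lemma iter_partial_bounded phi s : test_function phi ->
  exists B : R, forall x, `|iter_partial s phi x| <= B.
Proof.
move=> [phiS phiK]; have [sc _] := phiS s.
have := continuous_compact (continuous_subspaceT sc) phiK.
move=> /compact_bounded[B [_ BP]]; exists (`|B + 1|) => x.
have [xK|xK] := pselect (closure [set x | phi x != 0] x).
  rewrite (le_trans _ (ler_norm _))//.
  by apply: (BP (B + 1)); [rewrite ltrDl|exists x].
by rewrite iter_partial_supp// normr0.
Qed.

(** The second partial derivatives are continuous with compact support, hence
    bounded; the mean value theorem is applied to the first partial derivatives,
    then to the function itself. *)
Lemma test_function_c11 phi : test_function phi -> c11 phi (grad phi).
Proof.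
move=> phiT; have [phiS _] := phiT.
have /choice[B BP] : forall ij : 'I_d * 'I_d, exists B : R,
    forall x, `|partial ij.2 (partial ij.1 phi) x| <= B.
  by move=> [i j]; exact: (iter_partial_bounded [:: j; i] phiT).
have B0 ij : 0 <= B ij by exact: le_trans (BP ij 0).
pose S := \sum_ij B ij; have S0 : 0 <= S by exact: sumr_ge0.
have BS i j x : `|partial j (partial i phi) x| <= S.
  rewrite (le_trans (BP (i, j) x))// /S (bigD1 (i, j))//= lerDl.
  exact: sumr_ge0.
have plip x y : `|grad phi y - grad phi x| <= d%:R * S * `|y - x|.
  apply: norm_le_coord => [|i]; first by rewrite !mulr_ge0.
  rewrite !mxE -[leLHS](_ : `|partial i phi y - partial i phi x - dotp 0 (y - x)| = _).
    rewrite -mulrA; apply: partial_mean_value => [z j|z j _].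
      by have [_ /(_ z j)] := phiS [:: i].
    by rewrite mxE subr0.
  by rewrite dotp0l subr0.
exists (d%:R * S + d%:R * (d%:R * S)); first by rewrite addr_ge0// !mulr_ge0.
split=> x y.
  rewrite (le_trans (plip _ _))// ler_wpM2r// lerDl !mulr_ge0//.
rewrite (@le_trans _ _ (d%:R * (d%:R * S * `|y - x| * `|y - x|)))//.
  apply: partial_mean_value => [z j|z j zx].
    by have [_ /(_ z j)] := phiS [::].
  have := coord_le_norm (grad phi z - grad phi x) j; rewrite !mxE.
  move=> /le_trans; apply; rewrite (le_trans (plip _ _))// ler_wpM2l//.
  by rewrite mulr_ge0.
by rewrite expr2 !mulrA ler_wpM2r// ler_wpM2r// lerDr mulr_ge0.
Qed.

End regular_functions.

(** * Borel measurability in R^d *)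

Section borel.
Variables (R : realType) (d : nat).

Lemma open_borel (U : set 'rV[R]_d) : open U ->
  measurable (U : set (borelRV R d)).
Proof. by move=> oU; exact: sub_sigma_algebra. Qed.

Lemma closed_borel (F : set 'rV[R]_d) : closed F ->
  measurable (F : set (borelRV R d)).
Proof.
by move=> cF; have := measurableC (open_borel (closed_openC cF)); rewrite setCK.
Qed.

Lemma continuous_borel (f : 'rV[R]_d -> R) : continuous f ->
  measurable_fun [set: borelRV R d] (f : borelRV R d -> R).
Proof.
move=> /continuousP fo; apply: (measurability _ (RGenOpens.measurableE R)).
by move=> _ [_ [a [b ->] <-]]; rewrite setTI;
  exact: (open_borel (fo _ (@interval_open R (BRight a) (BLeft b) isT isT))).
Qed.

(** Open sets of R^d are countable unions of sup-norm balls with rational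
    centres, and those are cut out by conditions on single coordinates. *)
Lemma measurable_coordinates disp (X : measurableType disp)
    (W : X -> 'rV[R]_d) :
  (forall i, measurable_fun [set: X] (fun x => W x 0 i)) ->
  measurable_fun [set: X] (W : X -> borelRV R d).
Proof.
move=> mW.
apply: (@measurability _ _ _ (borelRV R d) _ _ (@open 'rV[R]_d)) => //.
move=> _ [U oU <-]; rewrite setTI.
pose c (q : 'rV[rat]_d) : 'rV[R]_d := map_mx ratr q.
pose B (qk : 'rV[rat]_d * nat) : set 'rV[R]_d :=
  [set x | forall i, `|x 0 i - c qk.1 0 i| < qk.2.+1%:R^-1].
pose F qk := if pselect (B qk `<=` U) then W @^-1` B qk else set0.
suff -> : W @^-1` U = \bigcup_qk F qk.
  apply: countable_bigcupT_measurable => [|qk]; first exact: countableP.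
  rewrite /F; case: pselect => //= BU.
  rewrite (_ : _ @^-1` _ = \bigcap_(i in [set: 'I_d])
      ((fun x => `|W x 0 i - c qk.1 0 i|) @^-1` `]-oo, qk.2.+1%:R^-1[)).
    apply: fin_bigcap_measurable => // i _; rewrite -[X in measurable X]setTI.
    apply: measurableT_comp => //.
    by apply: measurable_funB => //; exact: mW.
  by apply/seteqP; split=> x /= h i; [move=> _|]; have := h i; rewrite /= in_itv/=; apply.
apply/seteqP; split=> [x Ux|x [qk _]]; last first.
  by rewrite /F; case: pselect => // BU /BU.
have : nbhs (W x) U by exact: open_nbhs_nbhs.
move=> /nbhs_ballP[e /= e0 eU].
have [k ke] : exists k : nat, 2 * k.+1%:R^-1 <= e.
  exists (Num.truncn (2 / e)); rewrite ler_pdivrMr// mulrC -ler_pdivrMr//.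
  by rewrite ltW// truncnS_gt.
have /choice[q qP] : forall i, exists q : rat, `|W x 0 i - ratr q| < k.+1%:R^-1.
  move=> i; have lt : W x 0 i - k.+1%:R^-1 < W x 0 i.
    by rewrite ltrBlDr ltrDl invr_gt0.
  have [q] := rat_in_itvoo lt.
  rewrite in_itv/= => /andP[q1 q2]; exists q.
  by rewrite gtr0_norm ?subr_gt0// ltrBlDr addrC -ltrBlDr.
exists (\row_i q i, k) => //; rewrite /F; case: pselect => [BU /= i|BU].
  by rewrite /= !mxE; exact: qP.
exfalso; apply: BU => y yB; apply: eU; rewrite mx_norm_ball /ball_/=.
apply: (@lt_le_trans _ _ (2 * k.+1%:R^-1)) => //.
rewrite [ltLHS]/Num.Def.normr/= mx_normrE; apply/bigmax_ltP; split.
  by rewrite mulr_gt0// invr_gt0.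
move=> [i j] _ /=; rewrite ord1 !mxE.
have := yB j; rewrite /= !mxE distrC => yj; have := qP j.
have := ler_normD (W x 0 j - ratr (q j)) (ratr (q j) - y 0 j).
rewrite addrA subrK; move: yj; move: (_^-1) => t ? ? ?; lra.
Qed.

Lemma measurable_dotp disp (X : measurableType disp) (v w : X -> 'rV[R]_d) :
  (forall i, measurable_fun [set: X] (fun x => v x 0 i)) ->
  (forall i, measurable_fun [set: X] (fun x => w x 0 i)) ->
  measurable_fun [set: X] (fun x => dotp (v x) (w x)).
Proof.
move=> mv mw; apply: measurable_sum => i.
by apply: measurable_funM; [exact: mv|exact: mw].
Qed.

Lemma measurable_rVnorm disp (X : measurableType disp) (v : X -> 'rV[R]_d) :
  (forall i, measurable_fun [set: X] (fun x => v x 0 i)) ->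
  measurable_fun [set: X] (fun x => `|v x|).
Proof.
move=> mv; apply: (@measurableT_comp _ _ _ _ (borelRV R d) _
  (fun y : 'rV[R]_d => `|y|)); last exact: measurable_coordinates.
by apply: continuous_borel => x; exact: norm_continuous.
Qed.

Lemma lipschitz_continuous (f : 'rV[R]_d -> R) (C : R) :
  (forall x y, `|f x - f y| <= C * `|x - y|) -> continuous f.
Proof.
move=> fC x; apply/(@cvgrPdist_le _ _ _ (nbhs x) _ f) => /= e e0.
pose D := `|C| + 1; have D0 : 0 < D by rewrite ltr_pwDr.
near=> y; rewrite (le_trans (fC _ _))//.
rewrite (@le_trans _ _ (D * `|x - y|))//.
  by rewrite ler_wpM2r// (le_trans (ler_norm C))// lerDl.
rewrite mulrC -ler_pdivlMr//; near: y.
apply: filterS (nbhsx_ballx x _ (divr_gt0 e0 D0)) => z.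
by rewrite mx_norm_ball /ball_/= => /ltW.
Unshelve. all: by end_near. Qed.

Lemma c11_measurable u p i : @c11 R d u p ->
  measurable_fun [set: borelRV R d] (fun x : borelRV R d => p x 0 i).
Proof.
move=> [C C0 [pC _]]; apply: (continuous_borel (f := fun x => p x 0 i)).
apply: (@lipschitz_continuous _ C) => x y; apply: le_trans (pC x y).
by have := coord_le_norm (p x - p y) i; rewrite !mxE.
Qed.

End borel.

(** * Near-minimisers of a quadratic functional *)

(** The parallelogram identity makes near-minimisers of a quadratic functional
    close to each other.  Along decreasing sets stable under midpoints, the
    infima increase to a limit, so near-minimisers form a sequence that is
    Cauchy as fast as prescribed. *)
Lemma near_minimizers_cauchy (R : realType) (E : Type) (mid : E -> E -> E)
    (Q : E -> R) (dist : E -> E -> R) (C : nat -> set E) (B : R) (eta : nat -> R) :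
  (forall n, C n !=set0) -> (forall n, C n.+1 `<=` C n) ->
  (forall n x y, C n x -> C n y -> C n (mid x y)) ->
  (forall x, C 0%N x -> 0 <= Q x <= B) ->
  (forall x y, C 0%N x -> C 0%N y ->
     dist x y <= 2 * Q x + 2 * Q y - 4 * Q (mid x y)) ->
  (forall k, 0 < eta k) -> (forall k, eta k.+1 <= eta k) ->
  exists x : nat -> E, forall k, C k (x k) /\ dist (x k) (x k.+1) <= eta k.
Proof.
move=> C0 CS Cmid QB dQ eta0 etaS.
have Cle m n : (m <= n)%N -> C n `<=` C m.
  elim: n => [|n IH]; first by rewrite leqn0 => /eqP ->.
  by rewrite leq_eqVlt ltnS => /predU1P[->//|/IH]; apply: subset_trans.
have inf_ok n : has_inf (Q @` C n).
  have [x Cx] := C0 n; split; first by exists (Q x), x.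
  by exists 0 => _ [y /(Cle _ _ (leq0n n)) Cy <-]; have /andP[] := QB _ Cy.
pose I n := inf (Q @` C n).
have I_lb n x : C n x -> I n <= Q x.
  by move=> Cx; apply: ge_inf; [exact: (inf_ok n).2|exists x].
have I_mono m n : (m <= n)%N -> I m <= I n.
  move=> mn; apply: lb_le_inf; first by case: (inf_ok n).
  by move=> _ [y /(Cle _ _ mn) Cy <-]; exact: I_lb.
have I_sup : has_sup (range I).
  split; first by exists (I 0%N), 0%N.
  exists B => _ [n _ <-]; have [x Cx] := C0 n.
  by rewrite (le_trans (I_lb _ _ Cx))//; have /andP[] := QB _ (Cle _ _ (leq0n n) _ Cx).
pose L := sup (range I).
have I_le n : I n <= L by apply: ub_le_sup; [exact: I_sup.2|exists n].
pose delta k := eta k / 8; have delta0 k : 0 < delta k by rewrite divr_gt0.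
have pick k : exists nx : nat * E, [/\ (k <= nx.1)%N, C nx.1 nx.2,
    L - delta k <= I nx.1 & Q nx.2 <= L + delta k].
  have [_ [n _ <-] Ln] := sup_adherent (delta0 k) I_sup.
  pose N := maxn n k.
  have [_ [x Cx <-] Qx] := inf_adherent (delta0 k) (inf_ok N).
  exists (N, x); split => //=.
  - exact: leq_maxr.
  - by rewrite (le_trans (ltW Ln))// I_mono// leq_maxl.
  - by rewrite (le_trans (ltW Qx))// lerD2r; exact: I_le.
have [g gP] := choice pick.
exists (fun k => (g k).2) => k.
have [kN Ck Ik Qk] := gP k; have [kN1 Ck1 Ik1 Qk1] := gP k.+1.
split; first exact: (Cle _ _ kN).
pose n := minn (g k).1 (g k.+1).1.
have Cnk : C n (g k).2 by apply: (Cle _ (g k).1) => //; exact: geq_minl.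
have Cnk1 : C n (g k.+1).2 by apply: (Cle _ (g k.+1).1) => //; exact: geq_minr.
have In : L - delta k <= I n.
  rewrite /n; case: leqP => // _; rewrite (le_trans _ Ik1)// lerD2l lerN2.
  by rewrite /delta ler_pM2r ?invr_gt0// etaS.
have := I_lb _ _ (Cmid _ _ _ Cnk Cnk1).
have d0 := dQ _ _ (Cle _ _ (leq0n n) _ Cnk) (Cle _ _ (leq0n n) _ Cnk1).
have := etaS k; move: In Qk Qk1 d0; rewrite /delta => *.
lra.
Qed.

(** * Pairings of bounded fields *)

Section bounded_fields.
Variables (R : realType) (d : nat).
Variable mu : {finite_measure set (borelRV R d) -> \bar R}.
Implicit Types (p q s : 'rV[R]_d -> 'rV[R]_d) (phi psi : 'rV[R]_d -> R).

Definition bounded_field p (M : R) :=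
  (forall i, measurable_fun [set: borelRV R d] (fun x : borelRV R d => p x 0 i)) /\
  (forall x, `|p x| <= M).

Lemma bounded_field_comb (k l : R) p q M N :
  bounded_field p M -> bounded_field q N ->
  bounded_field (fun x => k *: p x + l *: q x) (`|k| * M + `|l| * N).
Proof.
move=> [mp pM] [mq qN]; split=> [i|x].
  have -> : (fun x : borelRV R d => (k *: p x + l *: q x) 0 i) =
      (fun x => k * p x 0 i + l * q x 0 i) by apply/funext => x; rewrite !mxE.
  by apply: measurable_funD; apply: measurable_funM.
by rewrite (le_trans (ler_normD _ _))// !normrZ lerD// ler_wpM2l.
Qed.

Lemma bounded_field_measurable p q M N :
  bounded_field p M -> bounded_field q N ->
  measurable_fun [set: borelRV R d] (fun x : borelRV R d => dotp (p x) (q x)).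
Proof. by move=> [mp _] [mq _]; exact: measurable_dotp. Qed.

Lemma bounded_field_dotp p q M N x :
  bounded_field p M -> bounded_field q N ->
  `|dotp (p x) (q x)| <= d%:R * (M * N).
Proof.
move=> [_ pM] [_ qN]; rewrite (le_trans (dotp_le _ _))// ler_wpM2l//.
by rewrite ler_pM.
Qed.

Lemma integrable_dotp p q M N : bounded_field p M -> bounded_field q N ->
  mu.-integrable [set: borelRV R d] (EFin \o (fun x => dotp (p x) (q x))).
Proof.
move=> pM qN; apply: measurable_bounded_integrable => //.
- exact: fin_num_fun_lty.
- exact: bounded_field_measurable pM qN.
- exists (d%:R * (M * N)); split; first exact: num_real.
  move=> y /ltW My x _; apply: le_trans My.
  exact: bounded_field_dotp pM qN.
Qed.

Definition pairing p q : R := \int[mu]_x dotp (p x) (q x).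

Lemma pairing_combr (k l : R) s p q K M N :
  bounded_field s K -> bounded_field p M -> bounded_field q N ->
  pairing s (fun x => k *: p x + l *: q x) = k * pairing s p + l * pairing s q.
Proof.
move=> sK pM qN.
have ip := integrable_dotp sK pM; have iq := integrable_dotp sK qN.
rewrite /pairing -!RintegralZl// -RintegralD//.
- by apply: eq_Rintegral => x _; rewrite dotpC dotpDl !dotpZl !(dotpC (s x)).
- by have := integrableZl measurableT k ip.
- by have := integrableZl measurableT l iq.
Qed.

Lemma pairing_le p q M N : bounded_field p M -> bounded_field q N ->
  `|pairing p q| <= d%:R * (M * N) * fine (mu setT).
Proof.
move=> pM qN; have ip := integrable_dotp pM qN.
rewrite (le_trans (le_normr_Rintegral _ ip))// -Rintegral_cst//.
apply: le_Rintegral => //.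
- by have := integrable_abse ip.
- exact: finite_measure_integrable_cst.
- by move=> x _; exact: bounded_field_dotp pM qN.
Qed.

(** [b] is the difference and [h] the midpoint of [p] and [q], written as
    linear combinations so that [pairing_combr] applies to them. *)
Lemma pairing_parallelogram p q M : bounded_field p M -> bounded_field q M ->
  let h x := 2^-1 *: p x + 2^-1 *: q x in let b x := 1 *: p x + -1 *: q x in
  pairing b b = 2 * pairing p p + 2 * pairing q q - 4 * pairing h h.
Proof.
move=> pM qM h b.
have hM := bounded_field_comb 2^-1 2^-1 pM qM; have bM := bounded_field_comb 1 (-1) pM qM.
have sym p' q' : pairing p' q' = pairing q' p'.
  by apply: eq_Rintegral => x _; exact: dotpC.
rewrite (pairing_combr _ _ bM pM qM) (pairing_combr _ _ hM pM qM).
rewrite !(sym b) !(sym h) !(pairing_combr _ _ pM pM qM) !(pairing_combr _ _ qM pM qM).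
by rewrite (sym q p); field.
Qed.

Lemma test_function_grad_bounded phi : test_function phi ->
  exists M, bounded_field (grad phi) M.
Proof.
move=> phiT; have c := test_function_c11 phiT.
have /choice[B BP] : forall i : 'I_d, exists B : R, forall x, `|partial i phi x| <= B.
  by move=> i; exact: (iter_partial_bounded [:: i] phiT).
exists (\sum_i B i); split=> [i|x]; first exact: c11_measurable c.
have B0 i : 0 <= B i by exact: le_trans (BP i 0).
apply: norm_le_coord => [|i]; first exact: sumr_ge0.
by rewrite mxE (le_trans (BP i x))// (bigD1 i)//= lerDl sumr_ge0.
Qed.

Lemma grad_comb (a : R) phi psi : test_function phi -> test_function psi ->
  grad (fun x => a * phi x + psi x) = (fun x => a *: grad phi x + 1 *: grad psi x).
Proof.
move=> [phiS _] [psiS _]; apply/funext => x; apply/rowP => i; rewrite !mxE mul1r.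
have [_ /(_ x i) dphi] := phiS [::]; have [_ /(_ x i) dpsi] := psiS [::].
rewrite /partial (_ : (fun y => a * phi y + psi y) = a *: phi + psi)//.
by rewrite deriveD ?deriveZ//; exact: derivableZ.
Qed.

(** So only the condition on sequences with bounded gradients can keep the
    divergence of a bounded field out of the Arens-Eells space. *)
Lemma neg_div_distribution s K : bounded_field s K ->
  Defs.distribution (neg_div mu s).
Proof.
move=> sK; split=> [a phi psi phiT psiT|phi_ phiT [_ phi0]].
  have [M phiM] := test_function_grad_bounded phiT.
  have [N psiN] := test_function_grad_bounded psiT.
  rewrite /neg_div grad_comb// -/(pairing s _).
  by rewrite (pairing_combr _ _ sK phiM psiN) mul1r.
have K0 : 0 <= K by case: sK => _ /(_ 0); exact: le_trans.
apply/cvgr0Pnorm_le => e e0.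
pose D := d%:R * K * fine (mu setT) + 1.
have muT0 : 0 <= fine (mu setT) by rewrite fine_ge0.
have D0 : 0 < D by rewrite ltr_wpDl// !mulr_ge0.
pose t := e / D; have t0 : 0 < t by rewrite divr_gt0.
have : \forall n \near \oo, forall i x, `|partial i (phi_ n) x| <= t.
  by apply: filter_forall => i; exact: phi0 [:: i] t t0.
apply: filterS => n nt.
have gt : bounded_field (grad (phi_ n)) t.
  split=> [i|x]; first exact: c11_measurable (test_function_c11 (phiT n)).
  by apply: norm_le_coord => [|i]; [exact: ltW|rewrite mxE].
rewrite (le_trans (pairing_le sK gt))//.
rewrite -[e](divfK (lt0r_neq0 D0)) -/t [leRHS]mulrC.
rewrite (_ : _ * _ = d%:R * K * fine (mu setT) * t); last by ring.
by rewrite ler_wpM2r ?(ltW t0)// lerDl.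
Qed.

End bounded_fields.

(** * Finite measures with real values *)

Section finite_measures.
Variables (R : realType) (disp : measure_display) (X : measurableType disp).
Variable mu : {finite_measure set X -> \bar R}.
Implicit Types A B : set X.

Definition rmeas A : R := fine (mu A).

Lemma rmeasE A : measurable A -> (rmeas A)%:E = mu A.
Proof. by move=> mA; rewrite /rmeas fineK// fin_num_measure. Qed.

Lemma rmeas_ge0 A : 0 <= rmeas A.
Proof. by rewrite fine_ge0. Qed.

Lemma le_rmeas A B : measurable A -> measurable B -> A `<=` B ->
  rmeas A <= rmeas B.
Proof.
by move=> mA mB AB; rewrite -lee_fin !rmeasE// le_measure// inE.
Qed.

Lemma rmeasU A B : measurable A -> measurable B ->
  rmeas (A `|` B) <= rmeas A + rmeas B.
Proof.
move=> mA mB; rewrite -lee_fin EFinD !rmeasE//; last exact: measurableU.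
exact: measureU2.
Qed.

Lemma rmeasDI A B : measurable A -> measurable B ->
  rmeas A = rmeas (A `\` B) + rmeas (A `&` B).
Proof.
move=> mA mB; apply: EFin_inj; rewrite EFinD !rmeasE//.
- exact: measureDI.
- exact: measurableI.
- exact: measurableD.
Qed.

Lemma rmeas_le_setU A B C : measurable A -> measurable B -> measurable C ->
  A `<=` B `|` C -> rmeas A <= rmeas B + rmeas C.
Proof.
move=> mA mB mC ABC; apply: le_trans (rmeasU mB mC).
by apply: le_rmeas => //; exact: measurableU.
Qed.

Lemma rmeas_bigcup_half (F : nat -> set X) (b : R) :
  (forall k, measurable (F k)) -> (forall k, rmeas (F k) <= b / 2 ^+ k.+1) ->
  rmeas (\bigcup_k F k) <= b.
Proof.
move=> mF Fb; have mU : measurable (\bigcup_k F k) by exact: bigcupT_measurable.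
rewrite -lee_fin rmeasE//.
rewrite (le_trans (measure_sigma_subadditive mu mF mU _))//.
have /(cvg_lim (@ereal_hausdorff R)) := @cvg_geometric_eseries_half R b 0.
rewrite expr0 divr1 => <-; apply: lee_nneseries => [k _ _|k _] //.
by rewrite /= -rmeasE// lee_fin addn1 natrX.
Qed.

Lemma rmeas_increasing (F : nat -> set X) (eps : R) : 0 < eps ->
  (forall k, measurable (F k)) -> nondecreasing_seq F ->
  exists N, rmeas (\bigcup_k F k) <= rmeas (F N) + eps.
Proof.
move=> eps0 mF ndF; have mU : measurable (\bigcup_k F k) by exact: bigcupT_measurable.
have : (EFin \o (rmeas \o F)) @ \oo --> (rmeas (\bigcup_k F k))%:E.
  rewrite rmeasE// (_ : EFin \o _ = mu \o F); first exact: nondecreasing_cvg_mu.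
  by apply/funext => k /=; rewrite rmeasE.
move=> /fine_cvgP[_ /cvgrPdist_le/(_ _ eps0)[N _ NF]]; exists N.
have /= := NF N (leqnn N); rewrite ler_norml => /andP[_]; lra.
Qed.

Lemma bigcup_ord_cover (F : nat -> set X) (eps : R) : 0 < eps ->
  (forall k, measurable (F k)) ->
  exists N, rmeas (\bigcup_k F k) <= rmeas (\bigcup_(k < N) F k) + eps.
Proof.
move=> eps0 mF; pose G N := \bigcup_(k < N) F k.
have mG N : measurable (G N) by exact: bigcup_measurable.
have ndG : nondecreasing_seq G.
  move=> m n mn; apply/subsetPset => x [k /= km Fx]; exists k => //=.
  exact: leq_trans mn.
have [N GN] := rmeas_increasing eps0 mG ndG; exists N.
rewrite (_ : \bigcup_k F k = \bigcup_k G k)//.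
apply/seteqP; split=> x; last by case=> k _ [j _ Fj]; exists j.
by case=> k _ Fk; exists k.+1 => //; exists k => /=.
Qed.

End finite_measures.

(** * Lipschitz functions non-derivable on a set of positive measure *)

Section extraction.
Variables (R : realType) (d : nat).
Variable mu : {finite_measure set (borelRV R d) -> \bar R}.
Implicit Types (p q s : 'rV[R]_d -> 'rV[R]_d) (phi psi : 'rV[R]_d -> R).

Let m := rmeas mu.

Lemma integrable_indic_comb (k l : R) (S : set (borelRV R d)) : measurable S ->
  mu.-integrable setT (EFin \o (fun x => k + l * \1_S x)).
Proof.
move=> mS; apply: measurable_bounded_integrable => //.
- exact: fin_num_fun_lty.
- by apply: measurable_funD => //; apply: measurable_funM => //; exact: measurable_indic.
- exists (`|k| + `|l|); split; first exact: num_real.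
  move=> y /ltW ky x _; apply: le_trans ky; rewrite (le_trans (ler_normD _ _))//.
  by rewrite lerD2l normrM ler_piMr// indicE; case: (_ \in _); rewrite ?normr1 ?normr0.
Qed.

Lemma Rintegral_indic_comb (k l : R) (S : set (borelRV R d)) : measurable S ->
  \int[mu]_x (k + l * \1_S x) = k * m setT + l * m S.
Proof.
move=> mS; have i1 := integrable_indic_comb 0 1 mS.
have i1' : mu.-integrable setT (EFin \o (\1_S : borelRV R d -> R)).
  apply: eq_integrable i1 => //= x _; by rewrite add0r mul1r.
rewrite RintegralD//.
- rewrite Rintegral_cst// RintegralZl// /Rintegral; congr (_ + _ * fine _).
  by rewrite integral_indic// setIT.
- exact: finite_measure_integrable_cst.
- by have := integrableZl measurableT l i1'.
Qed.

Lemma chebyshev_field p M (t : R) : bounded_field p M -> 0 < t ->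
  t ^+ 2 * m [set x | t < `|p x|] <= pairing mu p p.
Proof.
move=> pM t0; set S := [set x | _].
have mS : measurable (S : set (borelRV R d)).
  rewrite -[S]setTI (_ : S = (fun x => `|p x|) @^-1` `]t, +oo[).
    by apply: measurable_rVnorm => //; exact: pM.1.
  by apply/seteqP; split=> x /=; rewrite in_itv/= andbT.
have := Rintegral_indic_comb 0 (t ^+ 2) mS; rewrite mul0r add0r => <-.
apply: le_Rintegral => //.
- exact: integrable_indic_comb.
- exact: (integrable_dotp mu pM pM).
- move=> x _; rewrite add0r indicE; case: (boolP (x \in S)) => xS; last first.
    by rewrite mulr0 dotp_ge0.
  rewrite mulr1 -(sqr_sqrtr (dotp_ge0 (p x))) lerXn2r ?nnegrE ?sqrtr_ge0// ?ltW//.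
  by rewrite (lt_le_trans (set_mem xS))// norm_le_enorm.
Qed.

Lemma gradient_lipschitz phi (M : R) : test_function phi ->
  (forall x, `|grad phi x| <= M) ->
  forall x y, `|phi y - phi x| <= d%:R * (M * `|y - x|).
Proof.
move=> [phiS _] phiM x y; rewrite -[X in `|X|]subr0 -[X in _ - _ - X](dotp0l (y - x)).
apply: partial_mean_value => [z i|z i _].
  by have [_ /(_ z i)] := phiS [::].
rewrite mxE subr0; apply: le_trans (phiM z).
by have := coord_le_norm (grad phi z) i; rewrite mxE.
Qed.

Lemma norm_le_closed (r : R) : closed [set x : 'rV[R]_d | `|x| <= r].
Proof.
have := @preimage_closed _ _ (fun x : 'rV[R]_d => `|x|) [set y | y <= r].
by apply; [move=> x _; exact: norm_continuous|exact: closed_le].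
Qed.

Lemma norm_le_compact (r : R) : compact [set x : 'rV[R]_d | `|x| <= r].
Proof.
apply: bounded_closed_compact; last exact: norm_le_closed.
by exists r; split; [exact: num_real|move=> y /ltW ry x /= /le_trans; exact].
Qed.

(** By compactness of the ball: around each of its points, the common Lipschitz
    bound spreads the convergence at that point to a neighbourhood. *)
Lemma equilipschitz_cvg_uniform (phi_ : nat -> 'rV[R]_d -> R) (L c r : R) :
  (forall n x y, `|phi_ n y - phi_ n x| <= L * `|y - x|) ->
  (forall x, phi_ n x @[n --> \oo] --> c) ->
  forall eps : R, 0 < eps -> exists N, forall n x, (N <= n)%N -> `|x| <= r ->
    `|phi_ n x - c| <= eps.
Proof.
move=> phiL phic eps eps0.
have /compact_near_coveringP cov := @norm_le_compact r.
have [|N _ NP] := cov nat \oo (fun n x => `|phi_ n x - c| <= eps) _.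
  move=> x _; pose D : R := `|L| + 1; have D0 : 0 < D by rewrite ltr_pwDr.
  have e2 : 0 < eps / 2 by rewrite divr_gt0.
  have /cvgrPdistC_le/(_ _ e2)[N _ NP] := phic x.
  exists (ball x (eps / 2 / D), [set n | (N <= n)%N]) => /=.
    split; last by exists N.
    by apply: nbhsx_ballx; rewrite divr_gt0.
  move=> [y n] /= [+ /NP Nn]; rewrite mx_norm_ball /ball_/= => xy.
  rewrite -(subrK (phi_ n x) (phi_ n y)) -addrA (le_trans (ler_normD _ _))//.
  rewrite [eps]splitr lerD// (le_trans (phiL _ _ _))//.
  rewrite (@le_trans _ _ (D * `|y - x|))//.
    by rewrite ler_wpM2r// (le_trans (ler_norm L))// lerDl.
  by rewrite mulrC -ler_pdivlMr// distrC ltW.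
by exists N => n x Nn xr; exact: (NP n Nn x xr).
Qed.

(** The test functions of a sequence witnessing the failure become small on
    balls once their limit is subtracted, and multiplying them by the sign of
    their pairing with [s] makes this pairing positive.  Keeping [p] and the
    bounds, but forgetting that [u] is a test function, leaves conditions that
    are convex in [(u, p)]. *)
Lemma not_arens_eells_gradients s K : bounded_field s K ->
  ~ arens_eells (neg_div mu s) ->
  exists M delta : R, [/\ 0 <= M, 0 < delta & forall (r eps : R), 0 < eps ->
    exists u p, [/\ c11 u p, bounded_field p M,
      (forall x, `|x| <= r -> `|u x| <= eps) & delta <= pairing mu s p]].
Proof.
move=> sK /not_andP[/(_ (neg_div_distribution mu sK))//|].
move=> /existsNP[phi_ /not_implyP[phiT /not_implyP[[M gM] /not_implyP[[c phic]]]]].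
move=> Fphi; have {Fphi} [delta [delta0 Fdelta]] : exists delta : R, 0 < delta /\
    forall N, exists2 n, (N <= n)%N & delta < `|neg_div mu s (phi_ n)|.
  apply: contrapT => h; apply: Fphi; apply/cvgr0Pnorm_le => e e0.
  apply: contrapT => hN; apply: h; exists e; split=> // N.
  apply: contrapT => h; apply: hN; exists N => // n /= Nn.
  by rewrite leNgt; apply/negP => ne; apply: h; exists n.
have gM' n x : `|grad (phi_ n) x| <= M by rewrite (le_trans (norm_le_enorm _)).
have M0 : 0 <= M by rewrite (le_trans _ (gM' 0%N 0)).
exists M, delta; split=> // r eps eps0.
have phiL n x y : `|phi_ n y - phi_ n x| <= d%:R * M * `|y - x|.
  by rewrite -mulrA; exact: gradient_lipschitz.
have [N NP] := equilipschitz_cvg_uniform r phiL phic eps0.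
have [n Nn deltan] := Fdelta N.
pose sg : R := Num.sg (neg_div mu s (phi_ n)).
have sg1 : `|sg| = 1.
  rewrite normr_sg; case: eqVneq => // F0.
  by move: deltan; rewrite F0 normr0 ltNge ltW.
have gb : bounded_field (grad (phi_ n)) M.
  by split=> // i; exact: c11_measurable (test_function_c11 (phiT n)).
have c1 := c11_subr_cst c (test_function_c11 (phiT n)).
exists (fun x => sg * (phi_ n x - c) + 0 * (phi_ n x - c)).
exists (fun x => sg *: grad (phi_ n) x + 0 *: grad (phi_ n) x); split.
- exact: c11_comb.
- have := bounded_field_comb sg 0 gb gb.
  by rewrite sg1 normr0 mul1r mul0r addr0.
- by move=> x xr; rewrite mul0r addr0 normrM sg1 mul1r NP.
- rewrite (pairing_combr mu _ _ sK gb gb) mul0r addr0.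
  by rewrite ltW// (lt_le_trans deltan)// normrEsg mulrC.
Qed.

End extraction.

Section positive_measure.
Variables (R : realType) (d : nat).
Variable mu : {finite_measure set (borelRV R d) -> \bar R}.
Implicit Types (p q s : 'rV[R]_d -> 'rV[R]_d) (u f : 'rV[R]_d -> R).

Let m := rmeas mu.

Lemma borel_norm_le (r : R) :
  measurable ([set x : 'rV[R]_d | `|x| <= r] : set (borelRV R d)).
Proof. exact: (closed_borel (@norm_le_closed R d r)). Qed.

Lemma tail_of_space (b : R) : 0 < b ->
  exists2 r : R, 0 <= r & m (~` [set x : 'rV[R]_d | `|x| <= r]) <= b.
Proof.
move=> b0; pose F n : set (borelRV R d) := [set x : 'rV[R]_d | `|x| <= n%:R].
have mF n : measurable (F n) by exact: borel_norm_le.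
have ndF : nondecreasing_seq F.
  move=> i j ij; apply/subsetPset => x /= /le_trans; apply.
  by rewrite ler_nat.
have [N] := rmeas_increasing mu b0 mF ndF.
have -> : \bigcup_k F k = setT.
  apply/seteqP; split=> // x _; exists (Num.truncn `|x : 'rV[R]_d|).+1 => //=.
  by rewrite /F /= ltW// truncnS_gt.
move=> FN; exists N%:R => //.
have := rmeasDI mu measurableT (mF N); rewrite setTI setTD => mT.
rewrite -[X in m (~` X)]/(F N) /m; move: FN; rewrite mT addrC.
by rewrite lerD2l.
Qed.

(** The near-minimal pairs have gradients that are rapidly Cauchy in L^2, hence
    nearly constant along the sequence outside a set of small measure, whereas
    the lower bound on the pairing with [s] forces a definite slope along [s] on
    a set of larger measure.  On the difference of these sets the glued series is
    not derivable along [s]. *)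
Lemma nonderivable_of_not_arens_eells s : bounded_field s 1 ->
  ~ arens_eells (neg_div mu s) ->
  exists f, lipschitz_fun f /\ exists2 B : set (borelRV R d),
    measurable B & 0 < m B /\
    forall x, B x -> s x != 0 /\ ~ cvgn (dyadic_quotient f (s x) x).
Proof.
move=> s1 /(not_arens_eells_gradients s1)[M [delta [M0 delta0 H]]].
have T0 : 0 <= m setT := rmeas_ge0 mu setT.
(* K bounds s . p, c and b are the values for which s . p >= 2 c must hold on
   a set of measure at least b when its integral is at least delta, and e is the
   oscillation of the gradients that lipschitz_nonderivable tolerates. *)
pose K : R := d%:R * M + 1; have K0 : 0 < K by rewrite ltr_wpDl// mulr_ge0.
pose c : R := delta / (4 * (m setT + 1)).
have c0 : 0 < c by rewrite divr_gt0// mulr_gt0// ltr_wpDl.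
have cT : 2 * c * m setT <= delta / 2.
  have : c * (4 * (m setT + 1)) = delta.
    by rewrite divfK// gt_eqF// mulr_gt0// ltr_wpDl.
  by lra.
pose b : R := delta / (2 * K); have b0 : 0 < b by rewrite divr_gt0// mulr_gt0.
have bK : K * b = delta / 2 by rewrite /b invfM; field; rewrite gt_eqF.
pose D : R := 8 * d%:R + 16; have D0 : 0 < D by rewrite ltr_wpDl.
pose e : R := c / D; have e0 : 0 < e by rewrite divr_gt0.
have De : D * e = c by rewrite mulrC divfK// gt_eqF.
have de : d%:R * e <= c.
  have := ler0n R d; move: De; rewrite /D => ? ?; have : 0 <= d%:R * e by rewrite mulr_ge0// ltW.
  by lra.
have b4 : 0 < b / 4 by rewrite divr_gt0.
have [r r0 mr] := tail_of_space b4.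
pose E : Type := (('rV[R]_d -> R) * ('rV[R]_d -> 'rV[R]_d))%type.
pose C n : set E := [set z | [/\ c11 z.1 z.2, bounded_field z.2 M,
  (forall x, `|x| <= r + 2 -> `|z.1 x| <= n.+1%:R^-1) & delta <= pairing mu s z.2]].
pose mid (z z' : E) : E := (fun x => 2^-1 * z.1 x + 2^-1 * z'.1 x,
                            fun x => 2^-1 *: z.2 x + 2^-1 *: z'.2 x).
pose diff (z z' : E) x := 1 *: z.2 x + -1 *: z'.2 x.
pose t k : R := e * 2^-1 ^+ k.+2.
have t0 k : 0 < t k by rewrite mulr_gt0// exprn_gt0.
(* With this bound, Chebyshev's inequality gives measure b / 4 / 2 ^+ k.+1 to
   the set where the k-th increment exceeds t k. *)
pose eta k := t k ^+ 2 * (b / 4 / 2 ^+ k.+1).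
have [z zP] : exists z : nat -> E, forall k, C k (z k) /\
    pairing mu (diff (z k) (z k.+1)) (diff (z k) (z k.+1)) <= eta k.
  apply: (@near_minimizers_cauchy _ _ mid (fun z => pairing mu z.2 z.2)
    (fun z z' => pairing mu (diff z z') (diff z z')) C (d%:R * (M * M) * m setT)).
  - move=> n; have [|u [p [up pM ue dp]]] := H (r + 2) n.+1%:R^-1.
      by rewrite invr_gt0.
    by exists (u, p).
  - move=> n z [c1 bM ue dp]; split=> // x /ue /le_trans; apply.
    by rewrite lef_pV2 ?posrE// ler_nat.
  - move=> n [u p] [v q] [c1 bM ue dp] [/= c1' bM' ue' dp']; split=> /=.
    + exact: c11_comb.
    + have := bounded_field_comb 2^-1 2^-1 bM bM'.
      by rewrite ger0_norm// (_ : 2^-1 * M + 2^-1 * M = M)//; lra.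
    + move=> x xr; rewrite -mulrDr normrM ger0_norm//.
      have := ler_normD (u x) (v x); have := ue x xr; have := ue' x xr.
      by rewrite /=; move: (_^-1) => l; lra.
    + rewrite (pairing_combr mu _ _ s1 bM bM'); move: dp dp' => /=; lra.
  - move=> z [c1 bM ue dp]; apply/andP; split.
      by apply: Rintegral_ge0 => x _; exact: dotp_ge0.
    by rewrite (le_trans (ler_norm _))// pairing_le.
  - move=> z z' [_ bM _ _] [_ bM' _ _].
    by rewrite le_eqVlt (pairing_parallelogram mu bM bM') eqxx.
  - by move=> k; rewrite mulr_gt0 ?exprn_gt0// divr_gt0// exprn_gt0.
  - move=> k; rewrite /eta ler_pM//.
    + by rewrite sqr_ge0.
    + by rewrite divr_ge0 ?exprn_ge0// ltW.
    + rewrite lerXn2r ?nnegrE ?(ltW (t0 _))// ler_wpM2l ?(ltW e0)//.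
      by rewrite ler_wiXn2l ?invr_ge0// invf_le1// ler1n.
    + by rewrite ler_wpM2l ?(ltW b4)// lef_pV2 ?posrE ?exprn_gt0// ler_weXn2l// ler1n.
pose u k := (z k).1; pose p k := (z k).2.
have zC k : C k (z k) by case: (zP k).
have up k : c11 (u k) (p k) by case: (zC k).
have pM k : bounded_field (p k) M by case: (zC k).
have /choice[Cst CstP] : forall k, exists Ck : R, [/\ 0 <= Ck,
    (forall x y, `|p k x - p k y| <= Ck * `|x - y|) &
    (forall x y, `|u k y - u k x - dotp (p k x) (y - x)| <= Ck * `|y - x| ^+ 2)].
  by move=> k; have [Ck Ck0 [plip utay]] := up k; exists Ck.
have usmall (del : R) : 0 < del -> exists N, forall n x, (N <= n)%N ->
    `|x| <= r + 2 -> `|u n x| <= del.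
  move=> del0; exists (Num.truncn del^-1) => n x Nn xr.
  have [_ _ /(_ x xr) uk _] := zC n; rewrite (le_trans uk)//.
  rewrite invf_ple ?posrE// ltW// (lt_le_trans (truncnS_gt _))//.
  by rewrite ler_nat ltnS.
have [||||f [f_lip fP]] := @lipschitz_nonderivable _ _ r e M Cst u p r0 e0 _ _ _ _ usmall.
- by move=> k; case: (CstP k).
- by move=> k; case: (CstP k).
- by move=> k; case: (CstP k).
- by move=> k x; case: (pM k).
exists f; split => //.
have mfield q N : bounded_field q N ->
    measurable_fun [set: borelRV R d] (fun x : borelRV R d => `|q x|).
  by move=> qN; apply: measurable_rVnorm; exact: qN.1.
pose bad k : set (borelRV R d) := [set x | t k < `|diff (z k) (z k.+1) x|].
have diffM k : bounded_field (diff (z k) (z k.+1)) (`|1 : R| * M + `| -1 : R| * M).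
  exact: bounded_field_comb (pM k) (pM k.+1).
have mbad k : measurable (bad k).
  rewrite -[bad k]setTI (_ : bad k = (fun x => `|diff (z k) (z k.+1) x|) @^-1` `]t k, +oo[).
    by apply: (mfield _ _ (diffM k)).
  by apply/seteqP; split=> x /=; rewrite in_itv/= andbT.
have mbads : m (\bigcup_k bad k) <= b / 4.
  apply: rmeas_bigcup_half => // k.
  have := chebyshev_field mu (diffM k) (t0 k).
  case: (zP k) => _ /[swap] /le_trans /[apply].
  by rewrite /eta ler_pM2l// exprn_gt0.
(* On P0 the slope along s is at least 2 c; outside the bad sets it is then at
   least c for all the p k. *)
pose P0 : set (borelRV R d) := [set x | 2 * c <= dotp (s x) (p 0%N x)].
have mP0 : measurable P0.
  rewrite -[P0]setTI (_ : P0 = (fun x => dotp (s x) (p 0%N x)) @^-1` `[2 * c, +oo[).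
    by apply: (bounded_field_measurable s1 (pM 0%N)).
  by apply/seteqP; split=> x /=; rewrite in_itv/= andbT.
have P0_large : b <= m P0.
  have : delta <= 2 * c * m setT + K * m P0.
    rewrite -Rintegral_indic_comb//; case: (zC 0%N) => _ _ _ /le_trans; apply.
    apply: le_Rintegral => //.
    - exact: (integrable_dotp mu s1 (pM 0%N)).
    - exact: integrable_indic_comb.
    - move=> x _; rewrite indicE; have := bounded_field_dotp x s1 (pM 0%N).
      rewrite mul1r => /(le_trans (ler_norm _)) dM.
      have [xP|xP] := boolP (x \in P0); last first.
        rewrite mulr0 addr0 ltW// ltNge; apply/negP => h.
        by move/negP: xP; apply; rewrite inE.
      by rewrite mulr1 (le_trans dM)// /K; move: c0; lra.
  by move=> h; rewrite -(ler_pM2l K0) bK; move: h cT; lra.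
pose ball_r : set (borelRV R d) := [set x : 'rV[R]_d | `|x| <= r].
have mball : measurable ball_r by exact: borel_norm_le.
have mU : measurable (\bigcup_k bad k) by exact: bigcupT_measurable.
pose B : set (borelRV R d) := P0 `&` (ball_r `\` \bigcup_k bad k).
have mB : measurable B by apply: measurableI => //; exact: measurableD.
exists B => //; split.
  have mC : measurable (~` ball_r) by exact: measurableC.
  have : m P0 <= m B + m (~` ball_r `|` \bigcup_k bad k).
    apply: rmeas_le_setU => //; first exact: measurableU.
    move=> x P0x; have [xb|xb] := pselect (ball_r x); last by right; left.
    by have [xU|xU] := pselect ((\bigcup_k bad k) x); [right; right|left].
  have := rmeasU mu mC mU; move: b0 mr mbads P0_large; rewrite -/m -/ball_r.
  by move: (m _) (m _) (m _) (m _) (m _) => *; lra.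
move=> x [P0x [xr xbad]]; split.
  apply/eqP => sx0; move: P0x; rewrite /P0/= sx0 dotp0l.
  by rewrite leNgt mulr_gt0.
have px k : `|p k.+1 x - p k x| <= e * 2^-1 ^+ k.+2.
  rewrite distrC leNgt; apply/negP => h; apply: xbad; exists k => //.
  by rewrite /bad /diff /= scale1r scaleN1r.
have sx1 : `|s x| <= 1 by case: s1.
apply: (fP x (s x) c) => //; last by rewrite -/D De.
move=> k.
have pk0 : `|p 0%N x - p k x| <= e.
  by have := steps_to_tail px (leqnn 0) (leq0n k); rewrite expr0 mulr1.
have := dotp_le (p 0%N x - p k x) (s x); rewrite dotpBl.
have : d%:R * (`|p 0%N x - p k x| * `|s x|) <= d%:R * e.
  by rewrite ler_wpM2l// (le_trans _ pk0)// ler_piMr.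
move=> h /le_trans/(_ h)/(le_trans (ler_norm _)).
move: P0x; rewrite /P0/= ![dotp (s x) _]dotpC; lra.
Qed.

End positive_measure.

(** * Exhaustion *)

Section exhaustion.
Variables (R : realType) (disp : measure_display) (X : measurableType disp).
Variable mu : {finite_measure set X -> \bar R}.

Let m := rmeas mu.

(** The union of a sequence in [P] whose measures approach the supremum realises
    this supremum. *)
Lemma exhaustion (P : set (set X)) :
  (forall A, P A -> measurable A) -> P !=set0 ->
  (forall A : nat -> set X, (forall n, P (A n)) -> P (\bigcup_n A n)) ->
  (forall A, P A -> 0 < m (~` A) -> exists2 B, P B & m A < m B) ->
  exists2 A, P A & m (~` A) = 0.
Proof.
move=> mP [A0 PA0] PU Pgrow.
have ub : ubound (m @` P) (m setT).
  by move=> _ [A PA <-]; apply: le_rmeas => //; exact: mP.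
have sup_ok : has_sup (m @` P) by split; [exists (m A0), A0|exists (m setT)].
pose al := sup (m @` P).
have al_ub A : P A -> m A <= al by move=> PA; apply: sup_upper_bound => //; exists A.
have /choice[A AP] : forall n : nat, exists A, P A /\ al - n.+1%:R^-1 < m A.
  move=> n; have n0 : 0 < n.+1%:R^-1 :> R by rewrite invr_gt0.
  by have [_ [A PA <-] Al] := sup_adherent n0 sup_ok; exists A.
pose U := \bigcup_n A n.
have PU' : P U by apply: PU => n; case: (AP n).
exists U => //; apply/eqP; rewrite eq_le rmeas_ge0 andbT leNgt; apply/negP.
move=> /(Pgrow _ PU')[B PB]; rewrite ltNge => /negP; apply.
rewrite (le_trans (al_ub _ PB))//; apply/ler_addgt0Pl => eps eps0.
have [_] := AP (Num.truncn eps^-1); set k := Num.truncn _ => Ak.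
have kle : k.+1%:R^-1 <= eps.
  by rewrite invf_ple ?posrE// ltW// truncnS_gt.
have : m (A k) <= m U.
  apply: le_rmeas; [by apply: mP; case: (AP k)|exact: mP|].
  by move=> x Ax; exists k.
by move: Ak kle; move: (_^-1) => l; lra.
Qed.

Lemma disjoint_sequence_small (E : nat -> set X) (eps : R) : 0 < eps ->
  (forall i, measurable (E i)) ->
  (forall i j x, E i x -> E j x -> i = j) -> exists i, m (E i) <= eps.
Proof.
move=> eps0 mE dE; apply: contrapT => h.
have {}h i : eps < m (E i) by rewrite ltNge; apply/negP => le; apply: h; exists i.
pose U k := \bigcup_(i < k) E i.
have mU k : measurable (U k) by exact: bigcup_measurable.
have Uk k : k%:R * eps <= m (U k).
  elim: k => [|k IH]; first by rewrite mul0r rmeas_ge0.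
  rewrite /m (rmeasDI mu (mU k.+1) (mE k)) -(natr1 k) mulrDl mul1r lerD//.
    apply: (le_trans IH); apply: le_rmeas => //; first exact: measurableD.
    move=> x [i /= ik Ei]; split; first by exists i => //=; exact: ltnW.
    by move=> Ek; move: ik; rewrite (dE _ _ _ Ei Ek) ltnn.
  apply: (le_trans (ltW (h k))); apply: le_rmeas => //; first exact: measurableI.
  by move=> x Ek; split=> //; exists k => /=.
pose k := (Num.truncn (m setT / eps)).+1.
have : m setT < k%:R * eps by rewrite -ltr_pdivrMr// truncnS_gt.
rewrite ltNge => /negP; apply; apply: (le_trans (Uk k)).
by apply: le_rmeas.
Qed.

Lemma measurable_cvg_set (q : nat -> X -> R) :
  (forall k, measurable_fun [set: X] (q k)) ->
  measurable [set x | cvgn (q ^~ x)].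
Proof.
move=> mq.
rewrite (_ : mkset _ = \bigcap_n \bigcup_N \bigcap_(j in [set j | (N <= j)%N])
    [set x | `|q j x - q N x| <= n.+1%:R^-1]).
  apply: bigcapT_measurable => n; apply: bigcupT_measurable => N.
  apply: bigcap_measurable; first by exists N => /=.
  move=> j _; rewrite -[mkset _]setTI (_ : mkset _ = 
    (fun x => `|q j x - q N x|) @^-1` `]-oo, n.+1%:R^-1]); last first.
    by apply/seteqP; split=> x /=; rewrite in_itv.
  have : measurable_fun [set: X] (fun x => `|q j x - q N x|).
    by apply: measurableT_comp => //; exact: measurable_funB.
  exact.
apply/seteqP; split=> x /=.
  move=> cq n _; have n0 : 0 < n.+1%:R^-1 / 2 :> R by rewrite divr_gt0.
  have /cvgrPdist_le/(_ _ n0)[N _ NP] := cq; exists N => // j /= Nj.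
  rewrite -(subrK (limn (q ^~ x)) (q j x)) -addrA (le_trans (ler_normD _ _))//.
  rewrite [n.+1%:R^-1]splitr lerD//; last exact: NP (leqnn N).
  by rewrite distrC; exact: NP.
move=> h; apply: cauchy_cvg; apply: cauchy_exP => eps eps0.
pose n := Num.truncn eps^-1.
have nle : n.+1%:R^-1 < eps.
  by rewrite invf_plt ?posrE// truncnS_gt.
have [N _ NP] := h n I; exists (q N x); exists N => // j Nj.
by rewrite /ball/= distrC (le_lt_trans (NP j Nj)).
Qed.

End exhaustion.

Section nonderivable_sets.
Variables (R : realType) (d : nat).
Variable mu : {finite_measure set (borelRV R d) -> \bar R}.
Variable w : 'rV[R]_d -> 'rV[R]_d.
Hypothesis mw : forall i,
  measurable_fun [set: borelRV R d] (fun x : borelRV R d => w x 0 i).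
Implicit Types (f g : 'rV[R]_d -> R).

Let m := rmeas mu.

(** Dyadic scales suffice to exclude a one-sided derivative, and make this set
    measurable. *)
Definition nonderivable_set f : set (borelRV R d) :=
  [set x | ~ cvgn (dyadic_quotient f (w x) x)].

Lemma lipschitz_funD f g (t : R) : lipschitz_fun f -> lipschitz_fun g ->
  lipschitz_fun (fun x => f x + t * g x).
Proof.
move=> [L fL] [K gK]; exists (L + `|t| * K) => x y.
rewrite opprD addrACA -mulrBr (le_trans (ler_normD _ _))// normrM mulrDl.
by rewrite lerD// -mulrA ler_wpM2l.
Qed.

Lemma enorm_le (x : 'rV[R]_d) : enorm x <= Num.sqrt d%:R * `|x|.
Proof.
rewrite -[`|x|]normr_id -sqrtr_sqr -sqrtrM// ler_wsqrtr//.
have := dotp_le x x; by rewrite ger0_norm ?dotp_ge0// expr2.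
Qed.

Lemma lipschitz_fun_continuous f : lipschitz_fun f -> continuous f.
Proof.
move=> [L fL]; apply: (@lipschitz_continuous _ _ _ (`|L| * Num.sqrt d%:R)) => x y.
rewrite (le_trans (fL x y))// -mulrA (@le_trans _ _ (`|L| * enorm (x - y)))//.
  by rewrite ler_wpM2r ?sqrtr_ge0// ler_norm.
by rewrite ler_wpM2l// enorm_le.
Qed.

Lemma measurable_nonderivable_set f : lipschitz_fun f ->
  measurable (nonderivable_set f).
Proof.
move=> /lipschitz_fun_continuous/continuous_borel mf.
have mcoord i : measurable_fun [set: borelRV R d] (fun x : borelRV R d => x 0 i).
  by apply: (continuous_borel (f := fun x => x 0 i)); exact: coord_continuous.
apply: measurableC; apply: measurable_cvg_set => k.
apply: measurable_funM => //; apply: measurable_funB => //.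
apply: (@measurableT_comp _ _ _ _ (borelRV R d) _ f) => //.
apply: measurable_coordinates => i.
have -> : (fun x : borelRV R d => (x + 2^-1 ^+ k *: w x) 0 i) =
    (fun x => x 0 i + 2^-1 ^+ k * w x 0 i) by apply/funext => x; rewrite !mxE.
by apply: measurable_funD => //; exact: measurable_funM.
Qed.

Lemma dyadic_quotientD f g (t : R) v x :
  dyadic_quotient (fun x => f x + t * g x) v x =
  (fun k => dyadic_quotient f v x k + t * dyadic_quotient g v x k).
Proof. by apply/funext => k; rewrite /dyadic_quotient; ring. Qed.

(** For fixed [f] and [g], a given point is a derivability point of [f + i g]
    for two values of [i] only if it is one of both [f] and [g].  Hence the sets
    of points lost by [f + i g] are disjoint for distinct [i], and one of them
    is small. *)
Lemma nonderivable_setU f g (eps : R) : 0 < eps ->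
  lipschitz_fun f -> lipschitz_fun g -> exists2 h, lipschitz_fun h &
  m ((nonderivable_set f `|` nonderivable_set g) `\` nonderivable_set h) <= eps.
Proof.
move=> eps0 fL gL; pose h (i : nat) x := f x + i%:R * g x.
have hL i : lipschitz_fun (h i) by exact: lipschitz_funD.
pose E i := (nonderivable_set f `|` nonderivable_set g) `\` nonderivable_set (h i).
have mE i : measurable (E i).
  apply: measurableD; last exact: measurable_nonderivable_set.
  by apply: measurableU; exact: measurable_nonderivable_set.
suff [i Ei] : exists i, m (E i) <= eps by exists (h i).
apply: disjoint_sequence_small => // i j x [fg /contrapT hi] [_ /contrapT hj].
apply: contrapT => ij; have nij : i%:R - j%:R != 0 :> R.
  by rewrite subr_eq0 eqr_nat; apply/eqP.
move: hi hj; rewrite !dyadic_quotientD.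
set qf := dyadic_quotient f _ _ in fg *; set qg := dyadic_quotient g _ _ in fg *.
move=> hi hj; have cg : cvgn qg.
  rewrite (_ : qg = (fun k => (i%:R - j%:R)^-1 *
      ((qf k + i%:R * qg k) - (qf k + j%:R * qg k)))).
    by apply: is_cvgMr; exact: is_cvgB.
  by apply/funext => k; field.
case: fg => [|/(_ cg)//]; apply.
rewrite (_ : dyadic_quotient _ _ _ = (fun k => (qf k + i%:R * qg k) - i%:R * qg k)).
  by apply: is_cvgB => //; exact: is_cvgMr.
by apply/funext => k; rewrite addrK.
Qed.

(** [A] need not be contained in the non-derivability set of a Lipschitz
    function, but up to arbitrarily small measure it is in that of one. *)
Definition attainable (A : set (borelRV R d)) := measurable A /\
  forall eps : R, 0 < eps -> exists2 f, lipschitz_fun f &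
    m (A `\` nonderivable_set f) <= eps.

Lemma attainable_nonderivable f : lipschitz_fun f -> attainable (nonderivable_set f).
Proof.
move=> fL; split=> [|eps eps0]; first exact: measurable_nonderivable_set.
by exists f => //; rewrite setDv /m /rmeas measure0 ltW.
Qed.

Lemma lipschitz_fun0 : lipschitz_fun (fun _ : 'rV[R]_d => 0 : R).
Proof. by exists 0 => x y; rewrite subrr normr0 mul0r. Qed.

Lemma attainable0 : attainable set0.
Proof.
split=> // eps eps0; exists (fun _ => 0); first exact: lipschitz_fun0.
by rewrite set0D /m /rmeas measure0 ltW.
Qed.

Lemma attainableU A B : attainable A -> attainable B -> attainable (A `|` B).
Proof.
move=> [mA fA] [mB fB]; split=> [|eps eps0]; first exact: measurableU.
have eps3 : 0 < eps / 3 by rewrite divr_gt0.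
have [f fL Af] := fA _ eps3; have [g gL Bg] := fB _ eps3.
have [h hL fgh] := nonderivable_setU eps3 fL gL.
exists h => //.
have [mf mg mh] : [/\ measurable (nonderivable_set f), measurable (nonderivable_set g)
  & measurable (nonderivable_set h)] by split; exact: measurable_nonderivable_set.
have mAf : measurable (A `\` nonderivable_set f) by exact: measurableD.
have mBg : measurable (B `\` nonderivable_set g) by exact: measurableD.
have mfgh : measurable ((nonderivable_set f `|` nonderivable_set g) `\` nonderivable_set h).
  by apply: measurableD => //; exact: measurableU.
have mU : measurable ((A `\` nonderivable_set f) `|` (B `\` nonderivable_set g)).
  exact: measurableU.
have h1 := rmeasU mu mAf mBg.
have h2 : m ((A `|` B) `\` nonderivable_set h) <=
  m ((A `\` nonderivable_set f) `|` (B `\` nonderivable_set g)) +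
  m ((nonderivable_set f `|` nonderivable_set g) `\` nonderivable_set h).
  apply: rmeas_le_setU => //; first by apply: measurableD => //; exact: measurableU.
  move=> x [AB nh].
  have [nf|nf] := pselect (nonderivable_set f x); first by right; split => //; left.
  have [ng|ng] := pselect (nonderivable_set g x); first by right; split => //; right.
  by left; case: AB; [left|right].
move: h1 h2 Af Bg fgh; rewrite -/m => *; lra.
Qed.

Lemma attainable_bigcup (A : nat -> set (borelRV R d)) :
  (forall n, attainable (A n)) -> attainable (\bigcup_n A n).
Proof.
move=> aA; have mA n : measurable (A n) by case: (aA n).
have aU N : attainable (\bigcup_(n < N) A n).
  elim: N => [|N IH].
    by rewrite (_ : \bigcup_(n < 0) A n = set0) ?bigcup0//; exact: attainable0.
  rewrite (_ : \bigcup_(n < N.+1) A n = \bigcup_(n < N) A n `|` A N); first exact: attainableU.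
  apply/seteqP; split=> x.
    move=> [n /= nN An]; move: nN; rewrite ltnS leq_eqVlt => /predU1P[<-|nN]; first by right.
    by left; exists n.
  by move=> [[n /= nN An]|AN]; [exists n => //=; exact: ltnW|exists N => /=].
split=> [|eps eps0]; first exact: bigcupT_measurable.
have eps2 : 0 < eps / 2 by rewrite divr_gt0.
have [N AN] := bigcup_ord_cover mu eps2 mA.
have [mU /(_ _ eps2)[f fL Uf]] := aU N; exists f => //.
have mf := measurable_nonderivable_set fL.
have mV : measurable (\bigcup_n A n) by exact: bigcupT_measurable.
have := rmeasDI mu mV mU; rewrite setIidr; last by move=> x [n _ An]; exists n.
have : m (\bigcup_n A n `\` nonderivable_set f) <=
    m (\bigcup_n A n `\` \bigcup_(n < N) A n) +
    m (\bigcup_(n < N) A n `\` nonderivable_set f).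
  apply: rmeas_le_setU; try exact: measurableD.
  move=> x [Ax nf]; have [Ux|Ux] := pselect ((\bigcup_(n < N) A n) x); first by right.
  by left.
move: AN Uf; rewrite -/m => *; lra.
Qed.

Lemma nonderivable_almost_everywhere :
  (forall A : set (borelRV R d), measurable A -> 0 < m A -> exists2 f,
     lipschitz_fun f & 0 < m (A `&` nonderivable_set f)) ->
  forall eps : R, 0 < eps -> exists2 f, lipschitz_fun f &
    m (~` nonderivable_set f) <= eps.
Proof.
move=> H eps eps0.
have [|||A [mA /(_ _ eps0)[f fL Af]] mCA] := @exhaustion _ _ _ mu attainable _ _ attainable_bigcup.
- by move=> A [].
- by exists set0; exact: attainable0.
- move=> A aA mCA; have mA : measurable A by case: aA.
  have [f fL mf] := H _ (measurableC mA) mCA.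
  have mN := measurable_nonderivable_set fL.
  exists (A `|` nonderivable_set f).
    exact: attainableU (attainable_nonderivable fL).
  rewrite [ltRHS](rmeasDI mu (measurableU _ _ mA mN) mA).
  rewrite [_ `&` A]setIidr; last by move=> x; left.
  by rewrite setDUl setDv set0U setDE setIC ltrDr.
exists f => //; have mN := measurable_nonderivable_set fL.
have : m (~` nonderivable_set f) <= m (~` A) + m (A `\` nonderivable_set f).
  apply: rmeas_le_setU; [exact: measurableC|exact: measurableC|exact: measurableD|].
  by move=> x nf; have [Ax|Ax] := pselect (A x); [right|left].
by move: mCA Af; rewrite -/m => ->; lra.
Qed.

End nonderivable_sets.

(** * Inner regularity by compact sets *)

Section regularity.
Variables (R : realType) (d : nat).
Variable mu : {finite_measure set (borelRV R d) -> \bar R}.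

Let m := rmeas mu.

Definition regular_set (A : set (borelRV R d)) := measurable A /\
  forall eps : R, 0 < eps -> exists F U : set 'rV[R]_d,
    [/\ closed F, open U, F `<=` A, A `<=` U & m (U `\` F) <= eps].

Lemma regular_setC A : regular_set A -> regular_set (~` A).
Proof.
move=> [mA rA]; split=> [|eps eps0]; first exact: measurableC.
have [F [U [cF oU FA AU UF]]] := rA _ eps0.
exists (~` U), (~` F); split.
- exact: open_closedC.
- exact: closed_openC.
- exact: subsetC.
- exact: subsetC.
- by rewrite setDE setCK setIC -setDE.
Qed.

(** An open set is the increasing union of the closed sets of points at distance
    at least [n.+1%:R^-1] from its complement. *)
Lemma regular_open (U : set 'rV[R]_d) : open U -> regular_set U.
Proof.
move=> oU; have mU := open_borel oU; split=> // eps eps0.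
pose G n := \bigcup_(y in ~` U) ball y (n.+1%:R^-1 : R).
have oG n : open (G n) by apply: bigcup_open => y _; apply: ball_open.
pose F n : set (borelRV R d) := ~` G n.
have mF n : measurable (F n) by exact: (closed_borel (open_closedC (oG n))).
have ndF : nondecreasing_seq F.
  move=> i j ij; apply/subsetPset; apply: subsetC => x [y Uy xy]; exists y => //.
  by apply: le_ball xy; rewrite lef_pV2 ?posrE// ler_nat.
have FU : \bigcup_n F n = U.
  apply/seteqP; split=> [x [n _ nG]|x Ux].
    apply: contrapT => Ux; apply: nG; exists x => //.
    by apply: ballxx; rewrite invr_gt0.
  have : nbhs (x : 'rV[R]_d) U by exact: open_nbhs_nbhs.
  move=> /nbhs_ballP[e /= e0 eU]; exists (Num.truncn e^-1) => // -[y Uy xy].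
  apply: Uy; apply: eU; apply: ball_sym; apply: le_ball xy.
  by rewrite invf_ple ?posrE// ltW// truncnS_gt.
have [N] := rmeas_increasing mu eps0 mF ndF; rewrite FU => UN.
exists (F N), U; split => //.
- exact: open_closedC.
- by rewrite -[X in _ `<=` X]FU => x Fx; exists N.
- have := rmeasDI mu mU (mF N); rewrite setIidr; last first.
    by rewrite -[X in _ `<=` X]FU => x Fx; exists N.
  by move: UN; rewrite -/m; lra.
Qed.

Lemma regular_bigcup (A : nat -> set (borelRV R d)) :
  (forall n, regular_set (A n)) -> regular_set (\bigcup_n A n).
Proof.
move=> rA; have mA n : measurable (A n) by case: (rA n).
split=> [|eps eps0]; first exact: bigcupT_measurable.
have epsn n : 0 < eps / 2 / 2 ^+ n.+1 by rewrite !divr_gt0// exprn_gt0.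
have /choice[FU FUP] : forall n, exists FU : set 'rV[R]_d * set 'rV[R]_d,
    [/\ closed FU.1, open FU.2, FU.1 `<=` A n, A n `<=` FU.2 &
        m (FU.2 `\` FU.1) <= eps / 2 / 2 ^+ n.+1].
  move=> n; have [_ /(_ _ (epsn n))[F [U [cF oU FA AU UF]]]] := rA n.
  by exists (F, U).
pose F n : set (borelRV R d) := (FU n).1; pose U n : set (borelRV R d) := (FU n).2.
have cF n : closed (F n) by case: (FUP n).
have oU n : open (U n) by case: (FUP n).
have mF n : measurable (F n) by exact: closed_borel.
have mU n : measurable (U n) by exact: open_borel.
have eps2 : 0 < eps / 2 by rewrite divr_gt0.
have [N FN] := bigcup_ord_cover mu eps2 mF.
exists (\bigcup_(n < N) F n), (\bigcup_n U n); split.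
- rewrite bigcup_mkord; elim/big_ind : _ => [|X Y|i _] //; first exact: closed0.
  exact: closedU.
- by apply: bigcup_open.
- by move=> x [n _ Fx]; exists n => //; case: (FUP n) => _ _ + _ _; apply.
- by move=> x [n _ Ax]; exists n => //; case: (FUP n) => _ _ _ + _; apply.
- have mUn : measurable (\bigcup_n U n) by exact: bigcupT_measurable.
  have mFn : measurable (\bigcup_n F n) by exact: bigcupT_measurable.
  have mFN : measurable (\bigcup_(n < N) F n) by exact: bigcup_measurable.
  have mD n : measurable (U n `\` F n) by exact: measurableD.
  have UF : m (\bigcup_n (U n `\` F n)) <= eps / 2.
    by apply: rmeas_bigcup_half => // n; case: (FUP n).
  have mUF : measurable (\bigcup_n (U n `\` F n)) by exact: bigcupT_measurable.
  have : m (\bigcup_n U n `\` \bigcup_(n < N) F n) <=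
      m (\bigcup_n (U n `\` F n)) + m (\bigcup_n F n `\` \bigcup_(n < N) F n).
    apply: rmeas_le_setU => //; try exact: measurableD.
    move=> x [[n _ Ux] nF]; have [Fx|Fx] := pselect (F n x); last by left; exists n.
    by right; split => //; exists n.
  have := rmeasDI mu mFn mFN; rewrite setIidr; last by move=> x [n _ Fx]; exists n.
  by move: FN UF; rewrite -/m => *; lra.
Qed.

Lemma borel_regular (A : set (borelRV R d)) : measurable A -> regular_set A.
Proof.
apply: smallest_sub => [|U oU]; last exact: regular_open.
split=> [|B rB|B rB].
- exact: (regular_open open0).
- by rewrite setTD; exact: regular_setC.
- exact: regular_bigcup.
Qed.

Lemma inner_compact (A : set (borelRV R d)) (eps : R) : measurable A -> 0 < eps ->
  exists2 K : set 'rV[R]_d, compact K & K `<=` A /\ m (~` K) <= m (~` A) + eps.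
Proof.
move=> mA eps0; have eps2 : 0 < eps / 2 by rewrite divr_gt0.
have [_ /(_ _ eps2)[F [U [cF oU FA AU UF]]]] := borel_regular mA.
have [r _ mr] := tail_of_space mu eps2.
pose Br : set (borelRV R d) := [set x : 'rV[R]_d | `|x| <= r].
have mBr : measurable Br by exact: borel_norm_le.
have mF : measurable (F : set (borelRV R d)) by exact: closed_borel.
have mU : measurable (U : set (borelRV R d)) by exact: open_borel.
exists (Br `&` F).
  by apply: compact_closedI => //; exact: norm_le_compact.
split; first by move=> x [_ /FA].
have mUF : measurable ((U : set (borelRV R d)) `\` F) by exact: measurableD.
have mBC : measurable (~` Br) by exact: measurableC.
have mAC : measurable (~` A) by exact: measurableC.
have : m (~` (Br `&` F)) <= m (~` A) + m ((U `\` F) `|` ~` Br).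
  apply: rmeas_le_setU => //.
  - by apply: measurableC; exact: measurableI.
  - exact: measurableU.
  - move=> x nBF; have [Ax|Ax] := pselect (A x); last by left.
    have [Bx|Bx] := pselect (Br x); last by right; right.
    by right; left; split; [exact: AU|move=> Fx; apply: nBF].
have := rmeasU mu mUF mBC; move: UF mr; rewrite -/m -/Br => *; lra.
Qed.

End regularity.

(** * The theorem *)

Section one_sided.
Variables (R : realType) (d : nat).
Implicit Types (f : 'rV[R]_d -> R) (x v : 'rV[R]_d).

Lemma right_dderivable_dyadic f x v :
  right_dderivable f x v -> cvgn (dyadic_quotient f v x).
Proof.
move=> /cvg_ex[/= l fl]; apply/cvg_ex; exists l.
apply: cvg_comp fl => A [e /= e0 eA].
have [N NP] := half_small 1 (divr_gt0 e0 (ltr0n R 2)).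
exists N => // k /= Nk; apply: eA; last by rewrite /= exprn_gt0.
rewrite /ball/= sub0r normrN gtr0_norm ?exprn_gt0//.
have := NP k Nk; rewrite mul1r => /le_lt_trans; apply.
by rewrite ltr_pdivrMr// ltr_pMr// ltr1n.
Qed.

End one_sided.

Theorem proposition5p4 (R : realType) (d : nat)
    (mu : {finite_measure set (borelRV R d) -> \bar R})
    (T : 'rV[R]_d -> {vspace 'rV[R]_d}) (HT : MK_tangent_bundle mu T)
    (w : 'rV[R]_d -> 'rV[R]_d) (w_Linfty : Lvec mu +oo%E w)
    (w_unit : \forall x \ae mu, enorm (w x) = 1)
    (w_notin : \forall x \ae mu, w x \notin T x)
    (eps : R) (eps_gt0 : 0 < eps) :
  exists (K : set 'rV[R]_d) (f : 'rV[R]_d -> R),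
    [/\ compact K, (mu (~` K) <= eps%:E)%E, lipschitz_fun f &
        \forall x \ae mu, K x -> ~ right_dderivable f x (w x)].
Proof.
have mw i : measurable_fun [set: borelRV R d] (fun x : borelRV R d => w x 0 i).
  by have := w_Linfty i; rewrite inE => /andP[]; rewrite inE.
have nonderivable_part (A : set (borelRV R d)) : measurable A -> 0 < rmeas mu A ->
    exists2 f, lipschitz_fun f & 0 < rmeas mu (A `&` nonderivable_set w f).
  (* Cutting off where the norm exceeds 1 makes the field bounded everywhere and
     removes only a null set. *)
  move=> mA A0; pose A' : set (borelRV R d) := A `&` [set x | `|w x| <= 1].
  have mA' : measurable A'.
    apply: measurableI => //; rewrite -[X in measurable X]setTI.
    rewrite (_ : mkset _ = (fun x : borelRV R d => `|w x|) @^-1` `]-oo, 1]).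
      exact: (measurable_rVnorm mw).
    by apply/seteqP; split=> x /=; rewrite in_itv.
  pose s (x : 'rV[R]_d) : 'rV[R]_d := (\1_A' x : R) *: w x.
  have sE x : A' x -> s x = w x.
    by move=> A'x; rewrite /s indicE mem_set// scale1r.
  have sE0 x : ~ A' x -> s x = 0.
    by move=> A'x; rewrite /s indicE memNset// scale0r.
  have s1 : bounded_field s 1.
    split=> [i|x]; last first.
      have [A'x|A'x] := pselect (A' x); last by rewrite sE0// normr0.
      by rewrite sE//; case: A'x.
    have -> : (fun x : borelRV R d => s x 0 i) = (fun x => \1_A' x * w x 0 i).
      by apply/funext => x; rewrite mxE.
    by apply: measurable_funM => //; exact: measurable_indic.
  have sL1 : Lvec mu 1%E s.
    move=> i; apply/Lfun1_integrable; apply: measurable_bounded_integrable => //.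
    - exact: fin_num_fun_lty.
    - exact: s1.1.
    - exists 1; split; first exact: num_real.
      move=> y /ltW y1 x _; apply: le_trans y1.
      exact: le_trans (coord_le_norm _ _) (s1.2 x).
  have [|f [fL [B mB [B0 BP]]]] := @nonderivable_of_not_arens_eells _ _ mu s s1.
    move=> ae_s; have /(HT.2 s sL1) sT : MK_fields mu s by split.
    have : \forall x \ae mu, ~ A x.
      apply: (@filterS3 _ _ (ae_filter_ringOfSetsType mu) _ _ _ _ _ sT w_unit w_notin).
      move=> x sx wx /negP nwx Ax; apply: nwx.
      by rewrite -sE//; split => //=; rewrite (le_trans (norm_le_enorm _))// wx.
    move=> [N [mN N0 AN]].
    have : mu A = 0.
      by apply: (subset_measure0 mA mN _ N0) => x Ax; apply: AN => /(_ Ax).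
    by move=> muA; move: A0; rewrite /rmeas muA ltxx.
  exists f => //; rewrite (lt_le_trans B0)//; apply: le_rmeas => //.
    by apply: measurableI => //; exact: measurable_nonderivable_set.
  move=> x /BP[sx0 sx].
  have A'x : A' x by apply: contrapT => /sE0 s0; rewrite s0 eqxx in sx0.
  by rewrite sE// in sx; split; [case: A'x|].
have eps2 : 0 < eps / 2 by rewrite divr_gt0.
have [f fL fN] := nonderivable_almost_everywhere mw nonderivable_part eps2.
have mN := measurable_nonderivable_set mw fL.
have [K cK [KN mK]] := inner_compact mu mN eps2.
exists K, f; split => //.
  have mCK : measurable (~` K : set (borelRV R d)).
    have hausV : hausdorff_space 'rV[R]_d by exact: norm_hausdorff.
    exact: (open_borel (closed_openC (compact_closed hausV cK))).
  by rewrite -rmeasE// lee_fin; move: mK fN; lra.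
apply: aeW => x Kx /right_dderivable_dyadic; exact: KN.
Qed.
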